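(* Let $\mathsf{T}$ be an affine big tt-category such that the tensor unit $\mathbf{1}$ generates $\mathsf{T}$ and connectively generates a t-structure on $\mathsf{T}$. Then for all objects $X\in\mathsf{T}$ we have $$\mathrm{supp}^\bullet(X,\mathbf{1})=\bigcup_{i\in\mathbb{Z}}\mathrm{supp}(H^i(X),\mathbf{1}),$$ where the support on the left is twisted by the invertible object $\Sigma\mathbf{1}$ and the supports on the right are untwisted.
   Context: Big tt-category: a compactly generated triangulated category $\mathsf{T}$ with all set-indexed coproducts and suspension $\Sigma$, with a closed symmetric monoidal structure $(\otimes,\mathbf{1})$ such that $\otimes$ is exact and coproduct-preserving in each variable, $\Sigma$ is compatible with $\otimes$, and the full subcategory $\mathsf{T}^c$ of compact objects is a rigid tensor subcategory (in particular $\mathbf{1}\in\mathsf{T}^c$). $\mathrm{Spc}(\mathsf{T}^c)$ is the set of prime ideals of $\mathsf{T}^c$ (proper thick $\otimes$-ideals $\mathcal{P}$ such that $a\otimes b\in\mathcal{P}$ implies $a\in\mathcal{P}$ or $b\in\mathcal{P}$), with basis of open sets $U(a)=\{\mathcal{P}\mid a\in\mathcal{P}\}$, $a\in\mathsf{T}^c$; $\mathrm{supp}(a)=\{\mathcal{P}\mid a\notin\mathcal{P}\}$. Quasi-compact opens form a basis. For a quasi-compact open $U$ with closed complement $Z$, let $\mathsf{T}^c_Z=\{t\in\mathsf{T}^c\mid\mathrm{supp}(t)\subseteq Z\}$ and $\mathsf{T}(U)=\mathsf{T}/\mathrm{loc}(\mathsf{T}^c_Z)$ ($\mathrm{loc}$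 = localising subcategory generated); $X_U$ is the image of $X$ in $\mathsf{T}(U)$. $\mathcal{O}_{\mathsf{T}}$ is the sheaf of rings associated to $U\mapsto\mathrm{End}_{\mathsf{T}(U)}(\mathbf{1}_U)$, and $\mathrm{Spec}(\mathsf{T})=(\mathrm{Spc}(\mathsf{T}^c),\mathcal{O}_{\mathsf{T}})$. With $R_{\mathsf{T}}=\mathrm{End}_{\mathsf{T}}(\mathbf{1})$, Balmer's comparison map $\rho:\mathrm{Spec}(\mathsf{T})\to\mathrm{Spec}(R_{\mathsf{T}})$ is the map of locally ringed spaces $\rho(\mathcal{P})=\{f\in R_{\mathsf{T}}\mid\mathrm{cone}(f)\notin\mathcal{P}\}$, given on sections over $D(s)$ (with $\rho^{-1}(D(s))=U(\mathrm{cone}(s))$) by the isomorphism $R_{\mathsf{T}}[s^{-1}]\cong\mathrm{End}_{\mathsf{T}(U(\mathrm{cone}(s)))}(\mathbf{1})$ followed by sheafification. $\mathsf{T}$ is affine if $\rho$ is an isomorphism. Supports: the untwisted sheaf $[\mathbf{1},X]^\#$ is the sheaf associated to the presheaf $U\mapsto\mathrm{Hom}_{\mathsf{T}(U)}(\mathbf{1}_U,X_U)$ on quasi-compact opens, and $\mathrm{supp}(X,\mathbf{1})$ is the set of $\mathcal{P}\in\mathrm{Spc}(\mathsf{T}^c)$ at which its stalk is nonzero. The $\Sigma\mathbf{1}$-twisted support $\mathrm{supp}^\bullet(X,\mathbf{1})$ is defined in the same way using the presheaf $U\mapsto\bigoplus_{i\in\mathbb{Z}}\mathrm{Hom}_{\mathsf{T}(U)}(\mathbf{1}_U,(\Sigma^iX)_U)$.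 ''$\mathbf{1}$ generates $\mathsf{T}$'': $X=0$ whenever $\mathrm{Hom}_{\mathsf{T}}(\mathbf{1},\Sigma^iX)=0$ for all $i\in\mathbb{Z}$. ''$\mathbf{1}$ connectively generates a t-structure'': $\{\Sigma^i\mathbf{1}\}_{i\in\mathbb{Z}}$ is a generating set and $\mathrm{Hom}_{\mathsf{T}}(\mathbf{1},\Sigma^n\mathbf{1})=0$ for all $n>0$ (i.e. $\mathbf{1}$ is connective); the t-structure is then $\mathsf{T}^{\leq n}=\{X\mid\mathrm{Hom}_{\mathsf{T}}(\mathbf{1},\Sigma^iX)=0\ \forall i>n\}$, $\mathsf{T}^{\geq n}=\{X\mid\mathrm{Hom}_{\mathsf{T}}(\mathbf{1},\Sigma^iX)=0\ \forall i<n\}$. With truncation functors $\tau^{\leq n},\tau^{\geq n}$, the cohomology functors are $H^n(X)=\tau^{\geq0}\tau^{\leq0}\Sigma^nX\in\mathsf{T}^{\leq0}\cap\mathsf{T}^{\geq0}$. *)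

(* Defs.v *)
From Stdlib Require Relation_Operators.
From HB Require Import structures.
From mathcomp Require Import all_boot all_algebra.
From mathcomp Require Import all_classical topology.

Set Implicit Arguments.
Unset Strict Implicit.
Unset Printing Implicit Defensive.

Import GRing.Theory.
Local Open Scope classical_set_scope.
Local Open Scope ring_scope.

Declare Scope tt_scope.
Delimit Scope tt_scope with tt.
Local Open Scope tt_scope.

(******************************************************************************)
(* Smallness.  "Small" means "in the universe Set": hom-sets and the index    *)
(* types of coproducts live in Set, whereas the objects of a category form an *)
(* arbitrary Type.  Indexing coproducts by a universe that may contain the    *)
(* type of objects would force every such category to be trivial (Freyd).     *)
(******************************************************************************)

Record category := Category {
  ob :> Type;
  hom : ob -> ob -> Set;
  idm : forall X, hom X X;
  compm : forall X Y Z, hom Y Z -> hom X Y -> hom X Z;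
  comp_idl : forall X Y (f : hom X Y), compm (idm Y) f = f;
  comp_idr : forall X Y (f : hom X Y), compm f (idm X) = f;
  compA : forall W X Y Z (h : hom Y Z) (g : hom X Y) (f : hom W X),
    compm h (compm g f) = compm (compm h g) f }.

Arguments idm {c} X.
Notation "g ∘ f" := (compm g f) (at level 40, left associativity) : tt_scope.

Definition is_iso (C : category) (X Y : C) (f : hom X Y) :=
  exists g : hom Y X, g ∘ f = idm X /\ f ∘ g = idm Y.

Definition is_retract (C : category) (Y X : C) :=
  exists (i : hom Y X) (r : hom X Y), r ∘ i = idm Y.

Record preadditive := Preadditive {
  pa_cat :> category;
  hom0 : forall X Y : pa_cat, hom X Y;
  homN : forall X Y : pa_cat, hom X Y -> hom X Y;
  homD : forall X Y : pa_cat, hom X Y -> hom X Y -> hom X Y;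
  homDA : forall X Y : pa_cat, associative (@homD X Y);
  homDC : forall X Y : pa_cat, commutative (@homD X Y);
  hom0D : forall X Y : pa_cat, left_id (@hom0 X Y) (@homD X Y);
  homND : forall X Y : pa_cat, left_inverse (@hom0 X Y) (@homN X Y) (@homD X Y);
  homD_compl : forall (X Y Z : pa_cat) (g g' : hom Y Z) (f : hom X Y),
    homD g g' ∘ f = homD (g ∘ f) (g' ∘ f);
  homD_compr : forall (X Y Z : pa_cat) (g : hom Y Z) (f f' : hom X Y),
    g ∘ homD f f' = homD (g ∘ f) (g ∘ f') }.

HB.instance Definition _ (C : preadditive) (X Y : C) :=
  gen_eqMixin (hom X Y).
HB.instance Definition _ (C : preadditive) (X Y : C) :=
  gen_choiceMixin (hom X Y).
HB.instance Definition _ (C : preadditive) (X Y : C) :=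
  GRing.isZmodule.Build (hom X Y)
    (@homDA C X Y) (@homDC C X Y) (@hom0D C X Y) (@homND C X Y).

Lemma compDl (C : preadditive) (X Y Z : C) (g g' : hom Y Z) (f : hom X Y) :
  (g + g') ∘ f = g ∘ f + g' ∘ f.
Proof. exact: homD_compl. Qed.

Lemma compDr (C : preadditive) (X Y Z : C) (g : hom Y Z) (f f' : hom X Y) :
  g ∘ (f + f') = g ∘ f + g ∘ f'.
Proof. exact: homD_compr. Qed.

Lemma comp0m (C : preadditive) (X Y Z : C) (f : hom X Y) :
  (0 : hom Y Z) ∘ f = 0.
Proof. by apply: (addrI (0 ∘ f)); rewrite -compDl !addr0. Qed.

Definition is_zero (C : preadditive) (X : C) := idm X = 0.

Definition is_biproduct (C : preadditive) (X Y B : C) :=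
  exists (i1 : hom X B) (i2 : hom Y B) (p1 : hom B X) (p2 : hom B Y),
    [/\ p1 ∘ i1 = idm X, p2 ∘ i2 = idm Y,
        p1 ∘ i2 = 0, p2 ∘ i1 = 0 & i1 ∘ p1 + i2 ∘ p2 = idm B].

Definition is_coproduct (C : category) (I : Set) (F : I -> C) (S : C)
    (inj : forall i, hom (F i) S) :=
  forall (Y : C) (f : forall i, hom (F i) Y),
    exists! g : hom S Y, forall i, g ∘ inj i = f i.

(* Hom(X, -) commutes with coproducts: every map to a coproduct factors       *)
(* through finitely many summands.  Injectivity of the comparison map         *)
(* \bigoplus Hom(X, F i) -> Hom(X, \coprod F i) is automatic.                 *)
Definition compact_ob (C : preadditive) (X : C) :=
  forall (I : Set) (F : I -> C) (S : C) (inj : forall i, hom (F i) S),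
    is_coproduct inj ->
    forall f : hom X S, exists (s : seq I) (g : forall i, hom X (F i)),
      f = \sum_(i <- s) (inj i ∘ g i).

Record triangulated := Triangulated {
  tr_pa :> preadditive;
  tr_zero : exists Z : tr_pa, is_zero Z;
  tr_biprod : forall X Y : tr_pa, exists B, is_biproduct X Y B;
  susp : tr_pa -> tr_pa;
  suspm : forall X Y : tr_pa, hom X Y -> hom (susp X) (susp Y);
  suspm_id : forall X, suspm (idm X) = idm (susp X);
  suspm_comp : forall X Y Z (g : hom Y Z) (f : hom X Y),
    suspm (g ∘ f) = suspm g ∘ suspm f;
  suspmD : forall X Y (f g : hom X Y), suspm (f + g) = suspm f + suspm g;
  suspm_bij : forall X Y, bijective (@suspm X Y);
  desusp : tr_pa -> tr_pa;
  susp_desusp : forall X, exists f : hom (susp (desusp X)) X, is_iso f;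
  dist : forall X Y Z : tr_pa,
    hom X Y -> hom Y Z -> hom Z (susp X) -> Prop;
  dist_iso : forall X Y Z X' Y' Z'
    (f : hom X Y) (g : hom Y Z) (h : hom Z (susp X))
    (f' : hom X' Y') (g' : hom Y' Z') (h' : hom Z' (susp X'))
    (u : hom X X') (v : hom Y Y') (w : hom Z Z'),
    is_iso u -> is_iso v -> is_iso w ->
    v ∘ f = f' ∘ u -> w ∘ g = g' ∘ v -> suspm u ∘ h = h' ∘ w ->
    dist f g h -> dist f' g' h';
  dist_id : forall X Z, is_zero Z ->
    dist (idm X) (0 : hom X Z) (0 : hom Z (susp X));
  dist_cone : forall X Y (f : hom X Y),
    exists Z (g : hom Y Z) (h : hom Z (susp X)), dist f g h;
  dist_rot : forall X Y Z (f : hom X Y) (g : hom Y Z) (h : hom Z (susp X)),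
    dist f g h <-> dist g h (- suspm f);
  dist_mor : forall X Y Z X' Y' Z'
    (f : hom X Y) (g : hom Y Z) (h : hom Z (susp X))
    (f' : hom X' Y') (g' : hom Y' Z') (h' : hom Z' (susp X'))
    (u : hom X X') (v : hom Y Y'),
    dist f g h -> dist f' g' h' -> v ∘ f = f' ∘ u ->
    exists w : hom Z Z', w ∘ g = g' ∘ v /\ suspm u ∘ h = h' ∘ w;
  dist_oct : forall X Y Z A B C (f : hom X Y) (g : hom Y Z)
    (f1 : hom Y A) (f2 : hom A (susp X))
    (g1 : hom Z B) (g2 : hom B (susp Y))
    (k1 : hom Z C) (k2 : hom C (susp X)),
    dist f f1 f2 -> dist g g1 g2 -> dist (g ∘ f) k1 k2 ->
    exists (u : hom A C) (v : hom C B),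
      [/\ dist u v (suspm f1 ∘ g2),
          u ∘ f1 = k1 ∘ g, k2 ∘ u = f2,
          v ∘ k1 = g1 & g2 ∘ v = suspm f ∘ k2] }.

Definition shift (T : triangulated) (i : int) (X : T) : T :=
  match i with
  | Posz n => iter n (@susp T) X
  | Negz n => iter n.+1 (@desusp T) X
  end.

Definition cone (T : triangulated) (X Y : T) (f : hom X Y) : T :=
  sval (cid (dist_cone f)).

(* Closure under isomorphisms follows from the triangles X -> Y -> 0 -> and   *)
(* closure under all three terms from rotation and the clause on susp.        *)
Definition triangulated_sub (T : triangulated) (L : set T) :=
  [/\ forall Z, is_zero Z -> L Z,
      forall X, L (susp X) <-> L X &
      forall X Y Z (f : hom X Y) (g : hom Y Z) (h : hom Z (susp X)),
        dist f g h -> L X -> L Y -> L Z].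

Definition thick_sub (T : triangulated) (L : set T) :=
  triangulated_sub L /\ forall X Y, is_retract Y X -> L X -> L Y.

Definition localising_sub (T : triangulated) (L : set T) :=
  triangulated_sub L /\
  forall (I : Set) (F : I -> T) (S : T) (inj : forall i, hom (F i) S),
    is_coproduct inj -> (forall i, L (F i)) -> L S.

Definition loc_gen (T : triangulated) (A : set T) : set T :=
  [set X | forall L, localising_sub L -> A `<=` L -> L X].

Record tensor_triangulated := TensorTriangulated {
  tt_tr :> triangulated;
  tens : tt_tr -> tt_tr -> tt_tr;
  tensm : forall X X' Y Y' : tt_tr,
    hom X X' -> hom Y Y' -> hom (tens X Y) (tens X' Y');
  tensm_id : forall X Y, tensm (idm X) (idm Y) = idm (tens X Y);
  tensm_comp : forall X X' X'' Y Y' Y'' (f' : hom X' X'') (f : hom X X')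
    (g' : hom Y' Y'') (g : hom Y Y'),
    tensm (f' ∘ f) (g' ∘ g) = tensm f' g' ∘ tensm f g;
  tensmDl : forall X X' Y Y' (f f' : hom X X') (g : hom Y Y'),
    tensm (f + f') g = tensm f g + tensm f' g;
  tensmDr : forall X X' Y Y' (f : hom X X') (g g' : hom Y Y'),
    tensm f (g + g') = tensm f g + tensm f g';
  tunit : tt_tr;
  tassoc : forall X Y Z, hom (tens (tens X Y) Z) (tens X (tens Y Z));
  tassoci : forall X Y Z, hom (tens X (tens Y Z)) (tens (tens X Y) Z);
  tassocK : forall X Y Z, tassoci X Y Z ∘ tassoc X Y Z = idm _;
  tassociK : forall X Y Z, tassoc X Y Z ∘ tassoci X Y Z = idm _;
  tassoc_nat : forall X X' Y Y' Z Z' (f : hom X X') (g : hom Y Y')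
    (h : hom Z Z'),
    tassoc X' Y' Z' ∘ tensm (tensm f g) h = tensm f (tensm g h) ∘ tassoc X Y Z;
  lunit : forall X, hom (tens tunit X) X;
  lunit_iso : forall X, is_iso (lunit X);
  lunit_nat : forall X Y (f : hom X Y),
    lunit Y ∘ tensm (idm tunit) f = f ∘ lunit X;
  runit : forall X, hom (tens X tunit) X;
  runit_iso : forall X, is_iso (runit X);
  runit_nat : forall X Y (f : hom X Y),
    runit Y ∘ tensm f (idm tunit) = f ∘ runit X;
  braid : forall X Y, hom (tens X Y) (tens Y X);
  braid_nat : forall X X' Y Y' (f : hom X X') (g : hom Y Y'),
    braid X' Y' ∘ tensm f g = tensm g f ∘ braid X Y;
  braid_sym : forall X Y, braid Y X ∘ braid X Y = idm _;
  pentagon : forall W X Y Z,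
    tassoc W X (tens Y Z) ∘ tassoc (tens W X) Y Z =
    tensm (idm W) (tassoc X Y Z) ∘ tassoc W (tens X Y) Z
      ∘ tensm (tassoc W X Y) (idm Z);
  triangle : forall X Y,
    tensm (idm X) (lunit Y) ∘ tassoc X tunit Y = tensm (runit X) (idm Y);
  hexagon : forall X Y Z,
    tassoc Y Z X ∘ braid X (tens Y Z) ∘ tassoc X Y Z =
    tensm (idm Y) (braid X Z) ∘ tassoc Y X Z ∘ tensm (braid X Y) (idm Z);
  ihom : tt_tr -> tt_tr -> tt_tr;
  ihom_eval : forall Y Z, hom (tens (ihom Y Z) Y) Z;
  ihom_univ : forall X Y Z (f : hom (tens X Y) Z),
    exists! g : hom X (ihom Y Z), ihom_eval Y Z ∘ tensm g (idm Y) = f;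
  tsusp : forall X Y, hom (tens (susp X) Y) (susp (tens X Y));
  tsusp_iso : forall X Y, is_iso (tsusp X Y);
  tsusp_nat : forall X X' Y Y' (f : hom X X') (g : hom Y Y'),
    tsusp X' Y' ∘ tensm (suspm f) g = suspm (tensm f g) ∘ tsusp X Y;
  tsusp_unit : forall X, suspm (runit X) ∘ tsusp X tunit = runit (susp X);
  tsusp_assoc : forall X Y Z,
    suspm (tassoc X Y Z) ∘ tsusp (tens X Y) Z ∘ tensm (tsusp X Y) (idm Z) =
    tsusp X (tens Y Z) ∘ tassoc (susp X) Y Z;
  (* the two isomorphisms susp X ⊗ susp Y -> susp (susp (X ⊗ Y)) differ by    *)
  (* a sign; the suspension in the second variable is moved by the braiding   *)
  tsusp_sign : forall X Y,
    let tsuspr A B : hom (tens A (susp B)) (susp (tens A B)) :=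
      suspm (braid B A) ∘ tsusp B A ∘ braid A (susp B) in
    suspm (tsuspr X Y) ∘ tsusp X (susp Y) =
    - (suspm (tsusp X Y) ∘ tsuspr (susp X) Y);
  (* exactness; by the braiding it holds in the second variable as well       *)
  tens_exact : forall X Y Z W (f : hom X Y) (g : hom Y Z) (h : hom Z (susp X)),
    dist f g h ->
    dist (tensm f (idm W)) (tensm g (idm W)) (tsusp X W ∘ tensm h (idm W));
  tens_coprod : forall (I : Set) (F : I -> tt_tr) (S W : tt_tr)
    (inj : forall i, hom (F i) S),
    is_coproduct inj -> is_coproduct (fun i => tensm (inj i) (idm W)) }.

Notation "X ⊗ Y" := (tens X Y) (at level 40, left associativity) : tt_scope.
Notation "f ⊗m g" := (tensm f g) (at level 40, left associativity) : tt_scope.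
Arguments tunit {t}.
Notation "'𝟙'" := tunit : tt_scope.

Definition is_dual (T : tensor_triangulated) (X Y : T) :=
  exists (ev : hom (Y ⊗ X) 𝟙) (coev : hom 𝟙 (X ⊗ Y)),
    runit X ∘ (idm X ⊗m ev) ∘ tassoc X Y X ∘ (coev ⊗m idm X) = lunit X /\
    lunit Y ∘ (ev ⊗m idm Y) ∘ tassoci Y X Y ∘ (idm Y ⊗m coev) = runit Y.

Record big_tt_category := BigTT {
  big_tt :> tensor_triangulated;
  big_coprod : forall (I : Set) (F : I -> big_tt),
    exists (S : big_tt) (inj : forall i, hom (F i) S), is_coproduct inj;
  big_compactly_generated : exists (I : Set) (G : I -> big_tt),
    (forall i, compact_ob (G i)) /\
    forall X : big_tt,
      (forall i n (f : hom (G i) (shift n X)), f = 0) -> is_zero X;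
  big_unit_compact : compact_ob (𝟙 : big_tt);
  big_tens_compact : forall X Y : big_tt,
    compact_ob X -> compact_ob Y -> compact_ob (X ⊗ Y);
  big_rigid : forall X : big_tt, compact_ob X ->
    exists2 Y, compact_ob Y & is_dual X Y }.

Definition unit_end (T : tensor_triangulated) := hom (𝟙 : T) 𝟙.

Section UnitEnd.
Context (T : tensor_triangulated).
Notation R := (unit_end T).

HB.instance Definition _ := GRing.Zmodule.on R.

Let one : R := idm _.
Let mul (f g : R) : R := f ∘ g.

Let mulA : associative mul. Proof. by move=> f g h; exact: compA. Qed.
Let mul1l : left_id one mul. Proof. exact: comp_idl. Qed.
Let mul1r : right_id one mul. Proof. exact: comp_idr. Qed.
Let mulDl : left_distributive mul +%R.
Proof. by move=> f g h; exact: compDl. Qed.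
Let mulDr : right_distributive mul +%R.
Proof. by move=> f g h; exact: compDr. Qed.

(* f commutes with runit ∘ (id ⊗ g) ∘ runit^-1, and every endomorphism of 𝟙   *)
(* is of the latter form.                                                     *)
Let mulC : commutative mul.
Proof.
pose r := @runit T 𝟙; pose l := @lunit T 𝟙.
have [r' [r'r rr']] : is_iso r := runit_iso _.
have [l' [l'l ll']] : is_iso l := lunit_iso _.
pose conj (g : R) : R := r ∘ (idm 𝟙 ⊗m g) ∘ r'.
have comm f g : f ∘ conj g = conj g ∘ f.
  have fE : f ∘ r = r ∘ (f ⊗m idm 𝟙) by rewrite /r runit_nat.
  have fE' : (f ⊗m idm 𝟙) ∘ r' = r' ∘ f.
    by rewrite -[LHS]comp_idl -r'r -!compA (compA r) -fE -compA rr' comp_idr.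
  rewrite /conj !compA fE -!compA; congr (_ ∘ _).
  by rewrite -fE' !compA -!tensm_comp !(comp_idl, comp_idr).
have conjE (h : R) : h = conj (l ∘ r' ∘ h ∘ r ∘ l').
  have gE g : idm 𝟙 ⊗m g = l' ∘ g ∘ l.
    by rewrite -compA /l -lunit_nat compA l'l comp_idl.
  rewrite /conj gE !compA -(compA r l' l) l'l comp_idr rr' comp_idl.
  by rewrite -!compA (compA l' l) l'l comp_idl rr' comp_idr.
by move=> f g; rewrite /mul (conjE g) comm.
Qed.

HB.instance Definition _ :=
  GRing.Zmodule_isComPzRing.Build R mulA mulC mul1l mulDl.
End UnitEnd.

Definition is_tt_prime (T : tensor_triangulated) (P : set T) :=
  [/\ P `<=` @compact_ob T, thick_sub P,
      forall a p, compact_ob a -> P p -> P (a ⊗ p),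
      exists2 a, compact_ob a & ~ P a &
      forall a b, compact_ob a -> compact_ob b -> P (a ⊗ b) -> P a \/ P b].

Record Spc (T : tensor_triangulated) := MkSpc {
  Spc_set :> set T;
  Spc_prime : is_tt_prime Spc_set }.

Definition basic_U (T : tensor_triangulated) (a : T) : set (Spc T) :=
  [set P : Spc T | (P : set T) a].

Definition supp_compact (T : tensor_triangulated) (a : T) : set (Spc T) :=
  [set P : Spc T | ~ (P : set T) a].

HB.instance Definition _ (T : tensor_triangulated) := gen_eqMixin (Spc T).
HB.instance Definition _ (T : tensor_triangulated) := gen_choiceMixin (Spc T).
HB.instance Definition _ (T : tensor_triangulated) :=
  isSubBaseTopological.Build (Spc T) [set basic_U a | a in @compact_ob T] id.

Definition is_prime_ideal (R : comPzRingType) (p : set R) :=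
  [/\ p 0, forall a b, p a -> p b -> p (a + b), forall a b, p b -> p (a * b),
      ~ p 1 & forall a b, p (a * b) -> p a \/ p b].

Record Spec (R : comPzRingType) := MkSpec {
  Spec_set :> set R;
  Spec_prime : is_prime_ideal Spec_set }.

Definition basic_D (R : comPzRingType) (s : R) : set (Spec R) :=
  [set p : Spec R | ~ (p : set R) s].

HB.instance Definition _ (R : comPzRingType) := gen_eqMixin (Spec R).
HB.instance Definition _ (R : comPzRingType) := gen_choiceMixin (Spec R).
HB.instance Definition _ (R : comPzRingType) :=
  isSubBaseTopological.Build (Spec R) (range (@basic_D R)) id.

Lemma sig_eq A (P : A -> Prop) (x y : {a | P a}) : sval x = sval y -> x = y.
Proof.
case: x y => [x px] [y py] /= xy; rewrite {}xy in px *.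
by congr exist; exact: Prop_irrelevance.
Qed.

Section Quotient.
Context (A : Type) (r : A -> A -> Prop).

Definition gen_eq := Relation_Operators.clos_refl_sym_trans A r.

Definition quot := {c : set A | exists a, c = gen_eq a}.

Definition cls (a : A) : quot := exist _ (gen_eq a) (ex_intro _ a erefl).

Definition qrepr (c : quot) : A := sval (cid (svalP c)).

Lemma qreprK c : cls (qrepr c) = c.
Proof. by apply: sig_eq; rewrite /= -(svalP (cid (svalP c))). Qed.

Lemma clsP a b : cls a = cls b <-> gen_eq a b.
Proof.
split=> [/(congr1 sval) /= ab|ab].
  by rewrite ab; exact: Relation_Operators.rst_refl.
apply: sig_eq => /=; apply/seteqP; split=> c.
  by apply: Relation_Operators.rst_trans; exact: Relation_Operators.rst_sym.
exact: Relation_Operators.rst_trans.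
Qed.
End Quotient.

Definition qmap A B (r : A -> A -> Prop) (r' : B -> B -> Prop) (f : A -> B)
  (c : quot r) : quot r' := cls r' (f (qrepr c)).

Lemma qmap_cls A B (r : A -> A -> Prop) (r' : B -> B -> Prop) (f : A -> B) a :
  (forall x y, r x y -> r' (f x) (f y)) ->
  qmap r' f (cls r a) = cls r' (f a).
Proof.
move=> fr; apply/clsP; have /clsP := qreprK (cls r a).
move: (qrepr _) => b; elim=> [x y /fr|x|x y _|x y z _ + _].
- exact: Relation_Operators.rst_step.
- exact: Relation_Operators.rst_refl.
- exact: Relation_Operators.rst_sym.
- exact: Relation_Operators.rst_trans.
Qed.

Definition inverted (T : triangulated) (L : set T) (X Y : T) (s : hom X Y) :=
  exists Z (g : hom Y Z) (h : hom Z (susp X)), dist s g h /\ L Z.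

Section Verdier.
Context (T : triangulated) (L : set T) (X Y : T).

(* the fraction num ∘ den^-1 *)
Record roof := Roof {
  apex : T;
  den : hom apex X;
  num : hom apex Y;
  den_inverted : inverted L den }.

Definition roof_step (r r' : roof) :=
  exists t : hom (apex r') (apex r),
    den r' = den r ∘ t /\ num r' = num r ∘ t.

Definition vhom := quot roof_step.

Definition vfrac (A : T) (s : hom A X) (f : hom A Y) (sL : inverted L s) :
  vhom := cls roof_step (Roof f sL).

End Verdier.

Lemma inverted_id (T : triangulated) (L : set T) (X : T) :
  triangulated_sub L -> inverted L (idm X).
Proof.
move=> [L0 _ _]; have [Z Z0] := tr_zero T.
by exists Z, 0, 0; split; [exact: dist_id | exact: L0].
Qed.

Definition vloc (T : triangulated) (L : set T) (LT : triangulated_sub L)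
  (X Y : T) (f : hom X Y) : vhom L X Y := vfrac f (inverted_id X LT).

Lemma inverted_sub (T : triangulated) (L L' : set T) (X Y : T) (s : hom X Y) :
  L `<=` L' -> inverted L s -> inverted L' s.
Proof. by move=> LL' [Z [g [h [d /LL']]]]; exists Z, g, h. Qed.

Definition vres (T : triangulated) (L L' : set T) (LL' : L `<=` L') (X Y : T) :
  vhom L X Y -> vhom L' X Y :=
  qmap (@roof_step T L' X Y)
    (fun r => Roof (num r) (inverted_sub LL' (den_inverted r))).

Lemma vres_cls (T : triangulated) (L L' : set T) (LL' : L `<=` L') (X Y : T)
    (r : roof L X Y) :
  vres LL' (cls (@roof_step T L X Y) r) =
  cls (@roof_step T L' X Y)
    (Roof (num r) (inverted_sub LL' (den_inverted r))).
Proof. by rewrite /vres qmap_cls // => x y [t] /=; exists t. Qed.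

Lemma vres_id (T : triangulated) (L : set T) (LL : L `<=` L) (X Y : T)
    (c : vhom L X Y) : vres LL c = c.
Proof.
rewrite -(qreprK c) vres_cls; case: (qrepr c) => A s f sL /=.
by congr (cls _ (Roof _ _)); exact: Prop_irrelevance.
Qed.

Lemma vres_comp (T : triangulated) (L L' L'' : set T) (LL' : L `<=` L')
    (LL'' : L' `<=` L'') (LL2 : L `<=` L'') (X Y : T) (c : vhom L X Y) :
  vres LL'' (vres LL' c) = vres LL2 c.
Proof.
rewrite -(qreprK c) !vres_cls; case: (qrepr c) => A s f sL /=.
by congr (cls _ (Roof _ _)); exact: Prop_irrelevance.
Qed.

Lemma loc_gen_triangulated (T : triangulated) (A : set T) :
  triangulated_sub (loc_gen A).
Proof.
split=> [Z Z0 L LL _|X|X Y Z f g h d LX LY L LL AL].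
- by case: LL => -[+ _ _] _; apply.
- by split=> LX L LL AL; have /(_ _ LL AL) := LX; case: (LL) => -[_ S _] _ /S.
- case: (LL) => -[_ _ S] _; apply: (S _ _ _ _ _ _ d); [exact: LX|exact: LY].
Qed.

Lemma loc_gen_sub (T : triangulated) (A B : set T) :
  A `<=` B -> loc_gen A `<=` loc_gen B.
Proof. by move=> AB X AX L LL BL; apply: AX => // Y /AB /BL. Qed.

Lemma vres_vloc (T : triangulated) (L L' : set T) (LT : triangulated_sub L)
    (LT' : triangulated_sub L') (LL' : L `<=` L') (X Y : T) (f : hom X Y) :
  vres LL' (vloc LT f) = vloc LT' f.
Proof.
by rewrite /vloc /vfrac vres_cls; congr (cls _ (Roof _ _));
  exact: Prop_irrelevance.
Qed.

(* Only the underlying sets of the presheaves of abelian groups and rings are *)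
(* recorded: stalks and sheafification commute with the forgetful functor.    *)
(* Below, only the values on a base B of open sets matter.                    *)
Record presheaf (X : topologicalType) := Presheaf {
  psec :> set X -> Type;
  pres : forall U V, V `<=` U -> psec U -> psec V;
  pres_id : forall U (h : U `<=` U) a, pres h a = a;
  pres_comp : forall U V W (h : V `<=` U) (h' : W `<=` V) (h'' : W `<=` U) a,
    pres h' (pres h a) = pres h'' a }.

Section Stalk.
Context (X : topologicalType) (B : set (set X)) (F : presheaf X) (x : X).

Record germ_rep := GermRep {
  gr_set : set X;
  gr_base : B gr_set;
  gr_mem : gr_set x;
  gr_sec : F gr_set }.

Definition germ_step (g g' : germ_rep) :=
  exists h : gr_set g' `<=` gr_set g, gr_sec g' = pres h (gr_sec g).

Definition stalk := quot germ_step.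

Definition germ (U : set X) (BU : B U) (Ux : U x) (a : F U) : stalk :=
  cls germ_step (GermRep BU Ux a).
End Stalk.

Section Sheafification.
Context (X : topologicalType) (B : set (set X)) (F : presheaf X).

(* families of germs over U which are locally given by sections of F *)
Definition shsec (U : set X) :=
  {sigma : forall x, U x -> stalk B F x |
    forall x, U x -> exists (V : set X) (BV : B V) (a : F V), V x /\
      forall y (Uy : U y) (Vy : V y), sigma y Uy = germ BV Vy a}.

Definition shres (U V : set X) (VU : V `<=` U) (sigma : shsec U) : shsec V.
Proof.
exists (fun x Vx => sval sigma x (VU x Vx)) => x /VU Ux.
have [W [BW [a [Wx aP]]]] := svalP sigma x Ux.
by exists W, BW, a; split=> // y Vy Wy; exact: aP.
Defined.

Lemma shres_id U (h : U `<=` U) sigma : shres h sigma = sigma.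
Proof.
apply: sig_eq => /=; apply: functional_extensionality_dep => x.
by apply: functional_extensionality_dep => Ux; congr (sval sigma x _);
  exact: Prop_irrelevance.
Qed.

Lemma shres_comp U V W (h : V `<=` U) (h' : W `<=` V) (h'' : W `<=` U) sigma :
  shres h' (shres h sigma) = shres h'' sigma.
Proof.
apply: sig_eq => /=; apply: functional_extensionality_dep => x.
by apply: functional_extensionality_dep => Wx; congr (sval sigma x _);
  exact: Prop_irrelevance.
Qed.

Definition sheafify : presheaf X := Presheaf shres_id shres_comp.
End Sheafification.

Definition qcopen (X : topologicalType) : set (set X) :=
  [set U | open U /\ compact U].
Arguments qcopen : clear implicits.

Section Support.
Context (T : big_tt_category).

Definition compact_supported (Z : set (Spc T)) : set T :=
  [set t | compact_ob t /\ supp_compact t `<=` Z].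

Definition ker_at (U : set (Spc T)) : set T :=
  loc_gen (compact_supported (~` U)).

Lemma ker_at_triangulated U : triangulated_sub (ker_at U).
Proof. exact: loc_gen_triangulated. Qed.

Lemma ker_at_sub (U V : set (Spc T)) : V `<=` U -> ker_at U `<=` ker_at V.
Proof.
move=> VU; apply: loc_gen_sub => t [tc tU]; split=> // P /tU UP /VU //.
Qed.

Definition homat (X : T) (U : set (Spc T)) := vhom (ker_at U) 𝟙 X.

Definition homat_res (X : T) (U V : set (Spc T)) (VU : V `<=` U) :
  homat X U -> homat X V := @vres T _ _ (ker_at_sub VU) 𝟙 X.

Lemma homat_res_id X U (h : U `<=` U) (a : homat X U) : homat_res h a = a.
Proof. exact: vres_id. Qed.

Lemma homat_res_comp X U V W (h : V `<=` U) (h' : W `<=` V) (h'' : W `<=` U)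
  (a : homat X U) : homat_res h' (homat_res h a) = homat_res h'' a.
Proof. exact: vres_comp. Qed.

Definition homsheaf (X : T) : presheaf (Spc T) :=
  Presheaf (@homat_res_id X) (@homat_res_comp X).

Definition homat0 (X : T) (U : set (Spc T)) : homat X U :=
  vloc (ker_at_triangulated U) (0 : hom 𝟙 X).

Definition tw_homat (X : T) (U : set (Spc T)) :=
  {a : forall i : int, homat (shift i X) U |
    finite_set [set i | a i <> homat0 (shift i X) U]}.

Definition tw_res (X : T) (U V : set (Spc T)) (VU : V `<=` U)
  (a : tw_homat X U) : tw_homat X V.
Proof.
exists (fun i => homat_res VU (sval a i)).
apply: sub_finite_set (svalP a) => i /= + ai0; apply.
by rewrite ai0; exact: vres_vloc.
Defined.

Lemma tw_res_id X U (h : U `<=` U) (a : tw_homat X U) : tw_res h a = a.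
Proof.
apply: sig_eq => /=; apply: functional_extensionality_dep => i.
exact: homat_res_id.
Qed.

Lemma tw_res_comp X U V W (h : V `<=` U) (h' : W `<=` V) (h'' : W `<=` U)
  (a : tw_homat X U) : tw_res h' (tw_res h a) = tw_res h'' a.
Proof.
apply: sig_eq => /=; apply: functional_extensionality_dep => i.
exact: homat_res_comp.
Qed.

Definition tw_homsheaf (X : T) : presheaf (Spc T) :=
  Presheaf (@tw_res_id X) (@tw_res_comp X).

(* A group is nonzero iff it has two distinct elements. *)
Definition sheaf_support (F : presheaf (Spc T)) : set (Spc T) :=
  [set P | exists a b : stalk open (sheafify (qcopen (Spc T)) F) P, a <> b].

Definition supp (X : T) : set (Spc T) := sheaf_support (homsheaf X).

Definition tw_supp (X : T) : set (Spc T) := sheaf_support (tw_homsheaf X).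
End Support.

(* (a, n) stands for a / s ^ n *)
Definition frac_eq (R : comPzRingType) (s : R) (x y : R * nat) :=
  exists k : nat, s ^+ k * (s ^+ y.2 * x.1) = s ^+ k * (s ^+ x.2 * y.1).

Definition localization (R : comPzRingType) (s : R) := quot (frac_eq s).

Section Affine.
Context (T : big_tt_category).
Notation R := (unit_end T).

Definition struct_sheaf : presheaf (Spc T) :=
  sheafify (qcopen (Spc T)) (homsheaf (𝟙 : T)).

Definition rho (P : Spc T) : set R := [set f | ~ (P : set T) (cone f)].

Definition rho_opens (s : R) : set (Spc T) := basic_U (cone s).

(* sigma is the section a / s ^ n, i.e. it is locally the germ of the         *)
(* fraction a ∘ (s ^ n)^-1 in End_{T(V)}(𝟙)                                   *)
Definition is_frac_section (s a : R) (n : nat)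
    (sigma : struct_sheaf (rho_opens s)) :=
  forall P (sP : rho_opens s P),
    exists (V : set (Spc T)) (qcV : qcopen (Spc T) V) (VP : V P)
      (sV : inverted (ker_at V) (s ^+ n : R)),
      sval sigma P sP = germ (F := homsheaf (𝟙 : T)) qcV VP (vfrac a sV).

(* the graph of R[s^-1] = Γ(D(s), O_Spec(R)) -> Γ(U(cone s), O_T) *)
Definition rho_sharp (s : R) (x : localization s)
    (sigma : struct_sheaf (rho_opens s)) :=
  exists (a : R) (n : nat), x = cls _ (a, n) /\ is_frac_section a n sigma.

(* rho is an isomorphism of locally ringed spaces: a homeomorphism onto       *)
(* Spec R inducing bijections on the sections over the base D(s), s : R (a    *)
(* bijective ring morphism is an isomorphism).  The primality of rho P and    *)
(* the fact that rho_sharp is the graph of a function always hold.            *)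
Definition affine :=
  exists r : Spc T -> Spec R,
    [/\ forall P, (r P : set R) = rho P,
        bijective r,
        continuous r,
        forall U, open U -> open (r @` U) &
        forall s : R,
          (forall x, exists! sigma, rho_sharp (s := s) x sigma) /\
          (forall sigma, exists! x, rho_sharp (s := s) x sigma)].
End Affine.

Section TStructure.
Context (T : big_tt_category).
Implicit Types (X : T) (n : int).

Definition unit_generates :=
  forall X, (forall i (f : hom 𝟙 (shift i X)), f = 0) -> is_zero X.

Definition unit_connectively_generates :=
  (forall X, (forall i (f : hom (shift i 𝟙) X), f = 0) -> is_zero X) /\
  (forall n, (0 < n)%R -> forall f : hom (𝟙 : T) (shift n 𝟙), f = 0).

Definition t_le n : set T :=
  [set X | forall i, (n < i)%R -> forall f : hom 𝟙 (shift i X), f = 0].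

Definition t_ge n : set T :=
  [set X | forall i, (i < n)%R -> forall f : hom 𝟙 (shift i X), f = 0].

(* A -> X -> B -> is the truncation triangle of X, with A in degrees <= n and *)
(* B in degrees >= n + 1.                                                     *)
Definition is_truncation n X (AB : T * T) :=
  [/\ t_le n AB.1, t_ge (n + 1) AB.2 &
      exists (f : hom AB.1 X) (g : hom X AB.2) (h : hom AB.2 (susp AB.1)),
        dist f g h].

(* A choice of truncation triangle, unique up to unique isomorphism; one      *)
(* exists when 𝟙 connectively generates the t-structure.                      *)
Definition truncation n X : T * T :=
  match pselect (exists AB, is_truncation n X AB) with
  | left e => sval (cid e)
  | right _ => (X, X)
  end.

Definition tau_le n X : T := (truncation n X).1.
Definition tau_ge n X : T := (truncation (n - 1) X).2.

Definition cohomology n X : T := tau_ge 0 (tau_le 0 (shift n X)).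
End TStructure.

Arguments affine T : clear implicits.
Arguments unit_generates T : clear implicits.
Arguments unit_connectively_generates T : clear implicits.

(* Main.v *)
Require Import Defs.
From mathcomp Require Import all_boot all_algebra.
From mathcomp Require Import all_classical topology.
From mathcomp Require Import finmap zify.
Import Defs.

Set Implicit Arguments.
Unset Strict Implicit.
Unset Printing Implicit Defensive.

Import GRing.Theory.
Local Open Scope classical_set_scope.
Local Open Scope ring_scope.
Local Open Scope tt_scope.

(** Write R for the endomorphism ring of 𝟙 and, for a prime P, let S_P be the
    multiplicative set of the s in R with cone(s) in P, the complement of
    rho(P). Call a map f : 𝟙 -> X P-torsion if f ∘ s = 0 for some s in S_P. The
    theorem follows from two facts.

    The stalk at P of the sheaf associated with U |-> Hom_{T(U)}(𝟙, X) is the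
    localisation S_P^-1 Hom(𝟙, X). Hence P lies in supp X iff some map 𝟙 -> X
    is not P-torsion [supp_torsion], and P lies in the twisted support iff some
    map 𝟙 -> Σ^i X is not P-torsion [tw_supp_torsion]. The input is that every
    map from 𝟙 to an object that dies in T(U), for P in U, is P-torsion. If all
    compact objects are allowed in place of 𝟙, then the targets with this
    property form a localising subcategory, so it is enough that each object t
    of P is annihilated by some s in S_P.
    The compact objects annihilated by an element of S_P form a tensor ideal. If
    t were not in it, then, as ideals are radical by rigidity, some prime Q
    would contain this ideal but not t [prime_avoiding]. It contains cone(s)
    for each s in S_P, because s^2 annihilates cone(s); hence rho(Q) is
    contained in rho(P). But T is affine, so rho is a homeomorphism and
    therefore reflects specialisation: P is contained in Q, and t is in Q after
    all [prime_annihilated]. Affineness also provides the quasi-compact open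
    sets U(cone(s)) as a basis, so that germs and fractions can be compared on
    arbitrarily small quasi-compact open sets.

    Secondly, maps 𝟙 -> Σ^i X and maps 𝟙 -> H^i(X) are identified by
    composition with the maps of the truncation triangles, which respects
    P-torsion [torsion_cohomology]. The truncation triangles exist by the usual
    construction of an aisle: cone off all maps from the objects Σ^-i 𝟙 with
    i <= n, repeat countably often, and take the homotopy colimit; as 𝟙 is
    connective, this does not disturb the maps from Σ^-j 𝟙 with j > n
    [truncation_exists]. *)

(** * Additive categories and isomorphisms *)

Lemma compm0 (C : preadditive) (X Y Z : C) (f : hom Y Z) :
  f ∘ (0 : hom X Y) = 0.
Proof. by apply: (addrI (f ∘ 0)); rewrite -compDr !addr0. Qed.

Lemma compNm (C : preadditive) (X Y Z : C) (g : hom Y Z) (f : hom X Y) :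
  (- g) ∘ f = - (g ∘ f).
Proof. by apply: (addrI (g ∘ f)); rewrite -compDl !subrr comp0m. Qed.

Lemma compmN (C : preadditive) (X Y Z : C) (g : hom Y Z) (f : hom X Y) :
  g ∘ (- f) = - (g ∘ f).
Proof. by apply: (addrI (g ∘ f)); rewrite -compDr !subrr compm0. Qed.

Lemma compBl (C : preadditive) (X Y Z : C) (g g' : hom Y Z) (f : hom X Y) :
  (g - g') ∘ f = g ∘ f - g' ∘ f.
Proof. by rewrite compDl compNm. Qed.

Lemma compBr (C : preadditive) (X Y Z : C) (g : hom Y Z) (f f' : hom X Y) :
  g ∘ (f - f') = g ∘ f - g ∘ f'.
Proof. by rewrite compDr compmN. Qed.

Lemma comp_suml (C : preadditive) (X Y Z : C) I (s : seq I)
    (g : I -> hom Y Z) (f : hom X Y) :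
  (\sum_(i <- s) g i) ∘ f = \sum_(i <- s) (g i ∘ f).
Proof. by elim: s => [|i s IH]; rewrite ?big_nil ?comp0m // !big_cons compDl IH. Qed.

Lemma comp_sumr (C : preadditive) (X Y Z : C) I (s : seq I)
    (g : hom Y Z) (f : I -> hom X Y) :
  g ∘ (\sum_(i <- s) f i) = \sum_(i <- s) (g ∘ f i).
Proof. by elim: s => [|i s IH]; rewrite ?big_nil ?compm0 // !big_cons compDr IH. Qed.

Lemma is_zero_hom (C : preadditive) (X Z : C) (f : hom X Z) : is_zero Z -> f = 0.
Proof. by move=> Z0; rewrite -[f]comp_idl Z0 comp0m. Qed.

Lemma is_iso_id (C : category) (X : C) : is_iso (idm X).
Proof. by exists (idm X); rewrite comp_idl. Qed.

Lemma is_iso_comp (C : category) (X Y Z : C) (g : hom Y Z) (f : hom X Y) :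
  is_iso g -> is_iso f -> is_iso (g ∘ f).
Proof.
move=> [g' [g'g gg']] [f' [f'f ff']]; exists (f' ∘ g'); split.
  by rewrite -compA (compA g') g'g comp_idl.
by rewrite -compA (compA f) ff' comp_idl.
Qed.

Definition isomorphic (C : category) (X Y : C) := exists f : hom X Y, is_iso f.

Lemma isomorphic_refl (C : category) (X : C) : isomorphic X X.
Proof. by exists (idm X); exact: is_iso_id. Qed.

Lemma isomorphic_sym (C : category) (X Y : C) : isomorphic X Y -> isomorphic Y X.
Proof. by move=> [f [g [gf fg]]]; exists g, f. Qed.

Lemma isomorphic_trans (C : category) (X Y Z : C) :
  isomorphic X Y -> isomorphic Y Z -> isomorphic X Z.
Proof. by move=> [f If] [g Ig]; exists (g ∘ f); exact: is_iso_comp. Qed.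

Lemma isomorphic_retract (C : category) (X Y : C) :
  isomorphic X Y -> is_retract X Y.
Proof. by move=> [f [g [gf _]]]; exists f, g. Qed.

(** * Exactness of Hom functors on triangles *)

Section Triangulated.
Context (T : triangulated).
Implicit Types X Y Z C : T.

Lemma suspm0 X Y : suspm (0 : hom X Y) = 0.
Proof. by apply: (addrI (suspm 0)); rewrite -suspmD !addr0. Qed.

Lemma suspmN X Y (f : hom X Y) : suspm (- f) = - suspm f.
Proof. by apply: (addrI (suspm f)); rewrite -suspmD !subrr suspm0. Qed.

Lemma suspm_inj X Y : injective (@suspm T X Y).
Proof. exact: bij_inj (suspm_bij _ _). Qed.

Lemma suspm_surj X Y (g : hom (susp X) (susp Y)) : exists f, suspm f = g.
Proof. by have [k _ sk] := @suspm_bij T X Y; exists (k g). Qed.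

Lemma isomorphic_susp X Y : isomorphic X Y <-> isomorphic (susp X) (susp Y).
Proof.
split=> -[f [g [gf fg]]].
  by exists (suspm f), (suspm g); rewrite -!suspm_comp gf fg !suspm_id.
have [f' ?] := suspm_surj f; have [g' ?] := suspm_surj g; subst.
by exists f', g'; split; apply: suspm_inj; rewrite suspm_comp suspm_id.
Qed.

Lemma isomorphic_susp_desusp X : isomorphic (susp (desusp X)) X.
Proof. exact: susp_desusp. Qed.

Lemma is_zero_susp X : is_zero X -> is_zero (susp X).
Proof. by rewrite /is_zero -suspm_id => ->; exact: suspm0. Qed.

Section Triangle.
Context X Y Z (f : hom X Y) (g : hom Y Z) (h : hom Z (susp X)).
Context (d : dist f g h).

Lemma dist_comp0 : g ∘ f = 0.
Proof.
have [O O0] := tr_zero T.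
have e : f ∘ idm X = f ∘ idm X by [].
by have [w [<- _]] := dist_mor (dist_id X O0) d e; rewrite compm0.
Qed.

(** Compare the triangle with the trivial triangle 0 -> W -> W -> 0. *)
Lemma dist_extend W (k : hom Y W) : k ∘ f = 0 -> exists k', k = k' ∘ g.
Proof.
move=> kf; have [O O0] := tr_zero T.
have dW : dist (0 : hom O W) (idm W) (0 : hom W (susp O)).
  by apply/dist_rot; rewrite suspm0 oppr0; apply: dist_id; exact: is_zero_susp.
have e : k ∘ f = 0 ∘ (0 : hom X O) by rewrite kf comp0m.
by have [w [+ _]] := dist_mor d dW e; rewrite comp_idl => <-; exists w.
Qed.

(** Compare the trivial triangle C -> 0 -> ΣC with the rotation of the given one;
    the third map of the comparison desuspends to the lift. *)
Lemma dist_lift C (u : hom C Y) : g ∘ u = 0 -> exists u', u = f ∘ u'.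
Proof.
move=> gu; have [O O0] := tr_zero T.
have /dist_rot dC := dist_id C O0; have /dist_rot dg := d.
have e : (0 : hom O Z) ∘ (0 : hom C O) = g ∘ u by rewrite comp0m.
have [w [_]] := dist_mor dC dg e.
have [w' <-] := suspm_surj w.
rewrite suspm_id compmN compNm -suspm_comp comp_idr => /oppr_inj /suspm_inj ->.
by exists w'.
Qed.
End Triangle.

Section RotatedTriangle.
Context X Y Z (f : hom X Y) (g : hom Y Z) (h : hom Z (susp X)).
Context (d : dist f g h).

Lemma dist_comp0_rot : h ∘ g = 0.
Proof. by have /dist_rot/dist_comp0 := d. Qed.

Lemma dist_comp0_rot2 : suspm f ∘ h = 0.
Proof.
have /dist_rot/dist_rot/dist_comp0 := d.
by rewrite compNm => /eqP; rewrite oppr_eq0 => /eqP.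
Qed.

Lemma dist_extend_rot W (k : hom Z W) : k ∘ g = 0 -> exists k', k = k' ∘ h.
Proof. by have /dist_rot/dist_extend := d; exact. Qed.

Lemma dist_lift_rot C (u : hom C Z) : h ∘ u = 0 -> exists u', u = g ∘ u'.
Proof. by have /dist_rot/dist_lift := d; exact. Qed.

Lemma dist_lift_rot2 C (u : hom C (susp X)) :
  suspm f ∘ u = 0 -> exists u', u = h ∘ u'.
Proof.
move=> fu; have /dist_rot/dist_rot/dist_lift := d; apply.
by rewrite compNm fu oppr0.
Qed.
End RotatedTriangle.

Lemma dist_zero_cone X Y Z : isomorphic X Y -> is_zero Z ->
  exists f : hom X Y, dist f (0 : hom Y Z) 0.
Proof.
move=> [f If] Z0; exists f.
apply: (dist_iso (is_iso_id X) If (is_iso_id Z)) (dist_id X Z0).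
- by rewrite !comp_idr.
- by rewrite !comp0m compm0.
- by rewrite !comp0m compm0.
Qed.

(** An isomorphism has a zero cone. *)
Lemma triangulated_sub_iso (L : set T) X Y :
  triangulated_sub L -> isomorphic X Y -> L X -> L Y.
Proof.
move=> [L0 LS LC] XY LX; have [O O0] := tr_zero T.
have [f /dist_rot d] := dist_zero_cone (isomorphic_sym XY) O0.
by apply/LS; apply: LC d LX (L0 _ O0).
Qed.
End Triangulated.

(** * Coproducts and compact objects *)

Section Coproduct.
Context (C : preadditive) (I : Set) (F : I -> C) (S : C).
Context (inj : forall i, hom (F i) S) (cp : is_coproduct inj).

Lemma coproduct_ext Y (f g : hom S Y) :
  (forall i, f ∘ inj i = g ∘ inj i) -> f = g.
Proof.
by move=> fg; have [h [_ hu]] := cp (fun i => g ∘ inj i); rewrite -(hu f) ?(hu g).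
Qed.

(** The matrix of the j-th projection: the identity in position j, transported
    along i = j because F i and F j are different types otherwise. *)
Definition component_map (j i : I) : hom (F i) (F j) :=
  match pselect (i = j) with
  | left e => eq_rect i (fun k => hom (F i) (F k)) (idm (F i)) j e
  | right _ => 0
  end.

Definition coproj (j : I) : hom S (F j) := sval (cid (cp (component_map j))).

Lemma coproj_inj i : coproj i ∘ inj i = idm (F i).
Proof.
rewrite /coproj; case: cid => /= p [-> _]; rewrite /component_map.
by case: pselect => // e; rewrite (Prop_irrelevance e erefl).
Qed.

Lemma coproj_inj_neq i j : i <> j -> coproj j ∘ inj i = 0.
Proof.
by move=> ij; rewrite /coproj; case: cid => /= p [-> _];
  rewrite /component_map; case: pselect.
Qed.

(** The projector of S onto the finite subsum indexed by s. *)
Definition partial_id (s : seq {classic I}) : hom S S :=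
  \sum_(i <- undup s) (inj i ∘ coproj i).

Lemma partial_id_inj (s : seq {classic I}) (i : {classic I}) :
  i \in s -> partial_id s ∘ inj i = inj i.
Proof.
move=> si; rewrite /partial_id comp_suml (bigD1_seq i) ?mem_undup ?undup_uniq //=.
rewrite -compA coproj_inj comp_idr big1 ?addr0 // => j /eqP ji.
by rewrite -compA coproj_inj_neq ?compm0 // => ij; exact: ji.
Qed.

(** Stable under enlarging s, so that the supports of several maps can be
    merged; the index type carries its classical decidable equality. *)
Definition finitely_supported (X : C) (f : hom X S) :=
  exists s : seq {classic I}, forall t : seq {classic I},
    {subset s <= t} -> partial_id t ∘ f = f.

Lemma finitely_supportedP X (f : hom X S) :
  finitely_supported f <-> exists (s : seq I) (g : forall i, hom X (F i)),
      f = \sum_(i <- s) (inj i ∘ g i).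
Proof.
split=> [[s sP]|[s [g ->]]].
  exists (undup s), (fun i => coproj i ∘ f).
  by rewrite -[LHS](sP s) // /partial_id comp_suml; apply: eq_bigr => i _; rewrite compA.
exists s => t st; rewrite comp_sumr; apply: (@eq_big_seq _ _ _ {classic I}) => i /st ti.
by rewrite compA partial_id_inj.
Qed.

End Coproduct.

Lemma compact_ob_retract (C : preadditive) (X Y : C) :
  is_retract Y X -> compact_ob X -> compact_ob Y.
Proof.
move=> [i [r ri]] cX I F S inj cp f.
have [s [g fE]] := cX I F S inj cp (f ∘ r).
exists s, (fun j => g j ∘ i); rewrite -[f]comp_idr -ri compA fE comp_suml.
by apply: eq_bigr => j _; rewrite compA.
Qed.

Section CompactTriangulated.
Context (T : triangulated).
Implicit Types X Y Z : T.

Lemma suspm_sum X Y I (s : seq I) (f : I -> hom X Y) :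
  suspm (\sum_(i <- s) f i) = \sum_(i <- s) suspm (f i).
Proof. by elim: s => [|i s IH]; rewrite ?big_nil ?suspm0 // !big_cons suspmD IH. Qed.

(** Every map from ΣS to Y is u ∘ Σg for the isomorphism u : Σ(desusp Y) -> Y
    and a unique map g from S to desusp Y. *)
Lemma coproduct_susp (I : Set) (F : I -> T) (S : T) (inj : forall i, hom (F i) S) :
  is_coproduct inj -> is_coproduct (fun i => suspm (inj i)).
Proof.
move=> cp Y f; have [u [u' [u'u uu']]] := susp_desusp Y.
have f'P i : {f' | suspm f' = u' ∘ f i} := cid (suspm_surj (u' ∘ f i)).
have [g [gP gU]] := cp _ (fun i => sval (f'P i)).
exists (u ∘ suspm g); split=> [i|g2 g2P].
  by rewrite -compA -suspm_comp gP (svalP (f'P i)) compA uu' comp_idl.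
have [g2' g2E] := suspm_surj (u' ∘ g2).
rewrite (gU g2') ?g2E ?compA ?uu' ?comp_idl // => i; apply: suspm_inj.
by rewrite suspm_comp g2E (svalP (f'P i)) -compA g2P.
Qed.

(** The desuspension is a functor only up to the chosen isomorphisms
    Σ(desusp X) = X, so a coproduct is presented as the suspension of another
    one only up to isomorphisms u and v. *)
Lemma coproduct_desusp (I : Set) (F : I -> T) (S : T) (inj : forall i, hom (F i) S) :
  is_coproduct inj ->
  exists (F' : I -> T) (S' : T) (inj' : forall i, hom (F' i) S')
    (u : forall i, hom (susp (F' i)) (F i)) (v : hom (susp S') S),
  [/\ is_coproduct inj', is_iso v & forall i, v ∘ suspm (inj' i) = inj i ∘ u i].
Proof.
move=> cp; have [v Iv] := susp_desusp S; have [v' [v'v vv']] := Iv.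
pose uP i := cid (susp_desusp (F i)); pose u i := sval (uP i).
have u'P i := cid (svalP (uP i)); pose u' i := sval (u'P i).
have u'u i : u' i ∘ u i = idm _ by have [] := svalP (u'P i).
have uu' i : u i ∘ u' i = idm _ by have [] := svalP (u'P i).
pose kP i := cid (suspm_surj (v' ∘ inj i ∘ u i)); pose k i := sval (kP i).
have kE i : suspm (k i) = v' ∘ inj i ∘ u i := svalP (kP i).
exists (fun i => desusp (F i)), (desusp S), k, u, v; split=> // [Y f|i]; last first.
  by rewrite kE !compA vv' comp_idl.
have [g [gP gU]] := cp _ (fun i => suspm (f i) ∘ u' i).
have [g' g'E] := suspm_surj (g ∘ v); exists g'; split=> [i|g2 g2P].
  apply: suspm_inj; rewrite suspm_comp kE g'E -!compA (compA v) vv' comp_idl.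
  by rewrite compA gP -compA u'u comp_idr.
apply: suspm_inj; rewrite g'E (gU (suspm g2 ∘ v')) -?compA ?v'v ?comp_idr // => i.
by rewrite -g2P suspm_comp kE -!compA uu' comp_idr.
Qed.

Lemma compact_ob_susp X : compact_ob (susp X) <-> compact_ob X.
Proof.
split=> cX I F S inj cp f.
  have [s [g fE]] := cX _ _ _ _ (coproduct_susp cp) (suspm f).
  pose g'P i := cid (suspm_surj (g i)); exists s, (fun i => sval (g'P i)).
  apply: suspm_inj; rewrite fE suspm_sum; apply: eq_bigr => i _.
  by rewrite suspm_comp (svalP (g'P i)).
have [F' [S' [inj' [u [v [cp' [v' [_ vv']] vE]]]]]] := coproduct_desusp cp.
have [f' f'E] := suspm_surj (v' ∘ f).
have [s [g fE]] := cX _ _ _ _ cp' f'; exists s, (fun i => u i ∘ suspm (g i)).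
rewrite -[f]comp_idl -vv' -compA -f'E fE suspm_sum comp_sumr.
by apply: eq_bigr => i _; rewrite suspm_comp !compA vE.
Qed.

Lemma compact_ob_desusp X : compact_ob X -> compact_ob (desusp X).
Proof.
move=> cX; apply/compact_ob_susp; apply: compact_ob_retract cX.
exact/isomorphic_retract/isomorphic_susp_desusp.
Qed.

Lemma compact_ob_zero Z : is_zero Z -> compact_ob Z.
Proof.
move=> Z0 I F S inj cp f; exists [::], (fun=> 0).
by rewrite big_nil -[f]comp_idr Z0 compm0.
Qed.

(** The composite k ∘ g lands in a finite subsum; the rest of k factors through
    the compact object ΣX, so it lands in a finite subsum too. *)
Lemma compact_ob_cone X Y Z (f : hom X Y) (g : hom Y Z) (h : hom Z (susp X)) :
  dist f g h -> compact_ob X -> compact_ob Y -> compact_ob Z.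
Proof.
move=> d cX cY I F S inj cp k; apply/(finitely_supportedP cp).
have /(finitely_supportedP cp) [s sP] := cY _ _ _ _ cp (k ∘ g).
pose r := k - partial_id cp s ∘ k.
have [r' rE] : exists r', r = r' ∘ h.
  apply: (dist_extend_rot d); rewrite compBl -compA sP ?subrr //.
have /(finitely_supportedP cp) [t tP] :=
  (compact_ob_susp X).2 cX _ _ _ _ cp r'.
have kE : k = r + partial_id cp s ∘ k by rewrite subrK.
exists (s ++ t) => w stw.
have sw : {subset s <= w} by move=> i si; apply: stw; rewrite mem_cat si.
have tw : {subset t <= w} by move=> i ti; apply: stw; rewrite mem_cat ti orbT.
rewrite kE compDr rE compA tP // compA; congr (_ + _ ∘ _).
rewrite [in RHS]/partial_id comp_sumr; apply: (@eq_big_seq _ _ _ {classic I}) => i.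
by rewrite mem_undup => /sw wi; rewrite compA partial_id_inj.
Qed.

Lemma compact_ob_thick : thick_sub (@compact_ob T).
Proof.
split; last by move=> X Y; exact: compact_ob_retract.
split; [exact: compact_ob_zero|exact: compact_ob_susp|exact: compact_ob_cone].
Qed.

End CompactTriangulated.

(** * The action of the endomorphism ring of the unit *)

Section Action.
Context (T : tensor_triangulated).
Notation R := (unit_end T).
Implicit Types (X Y Z : T) (r s : R).

Definition runit_inv X : hom X (X ⊗ 𝟙) := sval (cid (runit_iso X)).

Lemma runitK X : runit_inv X ∘ runit X = idm _.
Proof. by rewrite /runit_inv; case: cid => /= ? []. Qed.

Lemma runit_invK X : runit X ∘ runit_inv X = idm _.
Proof. by rewrite /runit_inv; case: cid => /= ? []. Qed.

Lemma runit_inv_nat X Y (f : hom X Y) :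
  runit_inv Y ∘ f = (f ⊗m idm 𝟙) ∘ runit_inv X.
Proof.
by rewrite -[LHS]comp_idr -runit_invK -!compA (compA f) -runit_nat -compA !compA
  runitK comp_idl.
Qed.

(** Multiplication by s on X, written with the right unitor so that exactness of
    the tensor product in the first variable applies to it. *)
Definition act s X : hom X X := runit X ∘ (idm X ⊗m s) ∘ runit_inv X.

Lemma act_nat s X Y (f : hom X Y) : act s Y ∘ f = f ∘ act s X.
Proof.
rewrite /act -!compA runit_inv_nat !compA -runit_nat -!compA.
by congr (_ ∘ _); rewrite !compA -!tensm_comp !(comp_idl, comp_idr).
Qed.

Lemma act_mul r s X : act (r * s) X = act r X ∘ act s X.
Proof.
rewrite /act -!compA (compA (runit_inv X)) runitK comp_idl (compA (idm X ⊗m r)).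
by rewrite -tensm_comp comp_idl.
Qed.

(* Both unitors identify End(𝟙) with itself, and they differ by an
   automorphism of 𝟙, which is invisible since End(𝟙) is commutative. *)
Lemma act_unit s : act s 𝟙 = s.
Proof.
have [l' [l'l ll']] := lunit_iso (𝟙 : T).
have -> : act s 𝟙 = runit 𝟙 ∘ l' ∘ s ∘ (lunit 𝟙 ∘ runit_inv 𝟙).
  have sE : idm 𝟙 ⊗m s = l' ∘ s ∘ lunit 𝟙.
    by rewrite -compA -lunit_nat compA l'l comp_idl.
  by rewrite /act sE !compA.
have -> : runit 𝟙 ∘ l' ∘ s = s ∘ (runit 𝟙 ∘ l') :> R.
  exact: (mulrC (runit 𝟙 ∘ l' : R) s).
rewrite -!compA (compA l') l'l comp_idl runit_invK; exact: comp_idr.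
Qed.

Lemma act_susp s X : act s (susp X) = suspm (act s X).
Proof.
have [t [tK tK']] := tsusp_iso X (𝟙 : T).
have inv_susp : suspm (runit_inv X) = tsusp X 𝟙 ∘ runit_inv (susp X).
  rewrite -[RHS]comp_idl -suspm_id -runitK suspm_comp -!compA.
  by rewrite (compA (suspm (runit X))) tsusp_unit runit_invK comp_idr.
rewrite /act !suspm_comp inv_susp -(tsusp_unit X) -suspm_id -!compA.
by congr (_ ∘ _); rewrite !compA tsusp_nat.
Qed.

Lemma act0_tens s X Y : act s Y = 0 -> act s (X ⊗ Y) = 0.
Proof.
move=> sY; have sY0 : idm Y ⊗m s = 0.
  have -> : idm Y ⊗m s = runit_inv Y ∘ act s Y ∘ runit Y.
    by rewrite /act !compA runitK comp_idl -compA runitK comp_idr.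
  by rewrite sY compm0 comp0m.
have tens0 : idm X ⊗m (0 : hom (Y ⊗ 𝟙) (Y ⊗ 𝟙)) = 0.
  by apply: (addrI (idm X ⊗m 0)); rewrite -tensmDr !addr0.
have XY0 : idm (X ⊗ Y) ⊗m s = 0.
  by rewrite -[LHS]comp_idl -tassocK -compA -tensm_id tassoc_nat sY0 tens0 comp0m compm0.
by rewrite /act XY0 compm0 comp0m.
Qed.

Lemma act0_retract s X Y : is_retract Y X -> act s X = 0 -> act s Y = 0.
Proof.
by move=> [i [r ri]] sX; rewrite -[act s Y]comp_idr -ri compA act_nat sX compm0 comp0m.
Qed.

(** An endomorphism of Z that vanishes on Y factors through the connecting
    map to ΣX, and one that vanishes on X then annihilates what is left. *)
Lemma act0_cone r s X Y Z (f : hom X Y) (g : hom Y Z) (h : hom Z (susp X)) :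
  dist f g h -> g ∘ act r Y = 0 -> act s (susp X) ∘ h = 0 -> act (r * s) Z = 0.
Proof.
move=> d; rewrite -act_nat => rg sh.
have [k kE] := dist_extend_rot d rg.
by rewrite act_mul kE -compA -act_nat sh compm0.
Qed.

(** Both maps of 𝟙 -> cone s -> Σ𝟙 are killed by s. *)
Lemma act0_cone_sqr s : act (s * s) (cone s) = 0.
Proof.
rewrite /cone; case: cid => Z /= [g [h d]]; apply: (act0_cone d).
  by rewrite act_unit; exact: dist_comp0 d.
by rewrite act_susp act_unit; exact: dist_comp0_rot2 d.
Qed.

End Action.

(** * Prime tensor ideals *)

(** The chains are nonempty because the union of the empty one need not satisfy
    P; the start P0 is adjoined to every member to make up for it. *)
Lemma Zorn_above T (P : set (set T)) (P0 : set T) :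
  P P0 ->
  (forall F : set (set T), F !=set0 -> F `<=` P -> total_on F subset ->
    P (\bigcup_(A in F) A)) ->
  exists M, [/\ P M, P0 `<=` M & forall B, P B -> M `<=` B -> B `<=` M].
Proof.
move=> PP0 chain.
have [F FP tF|A [QA Amax]] := @Zorn_bigcup _ [set A | P (P0 `|` A)].
  have [[A FA]|F0] := pselect (F !=set0); last first.
    rewrite /= (_ : F = set0) ?bigcup_set0 ?setU0 //.
    by apply: contrapT => /eqP/set0P.
  rewrite /= (_ : _ `|` _ = \bigcup_(B in [set P0 `|` A | A in F]) B).
    apply: chain; first by exists (P0 `|` A), A.
      by move=> _ [B /FP ? <-].
    move=> _ _ [B FB <-] [C FC <-].
    by have [BC|CB] := tF _ _ FB FC; [left|right]; exact: setUS.
  apply/seteqP; split=> [x [P0x|[B FB Bx]]|x [_ [B FB <-]] [P0x|Bx]].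
  - by exists (P0 `|` A); [exists A|left].
  - by exists (P0 `|` B); [exists B|right].
  - by left.
  - by right; exists B.
exists (P0 `|` A); split=> // B PB AB.
have [BA|nBA] := pselect (B `<=` A); first by move=> x /BA; right.
have /Amax[] : A `<` B by split=> // x Ax; apply: AB; right.
by rewrite /= (iffRL (setUidPr _ _)) // => x P0x; apply: AB; left.
Qed.

Definition tt_ideal (T : tensor_triangulated) (J : set T) :=
  [/\ J `<=` @compact_ob T, thick_sub J &
      forall a p, compact_ob a -> J p -> J (a ⊗ p)].

Section Ideals.
Context (T : big_tt_category).
Implicit Types (X Y Z a b t : T) (J : set T).

Lemma tens_isoC X Y : isomorphic (X ⊗ Y) (Y ⊗ X).
Proof. by exists (braid X Y), (braid Y X); rewrite !braid_sym. Qed.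

Lemma tens_isoA X Y Z : isomorphic (X ⊗ Y ⊗ Z) (X ⊗ (Y ⊗ Z)).
Proof. by exists (tassoc X Y Z), (tassoci X Y Z); rewrite tassocK tassociK. Qed.

Lemma tens_iso X X' Y : isomorphic X X' -> isomorphic (X ⊗ Y) (X' ⊗ Y).
Proof.
move=> [f [g [gf fg]]]; exists (f ⊗m idm Y), (g ⊗m idm Y).
by rewrite -!tensm_comp gf fg comp_idl !tensm_id.
Qed.

Lemma tens_retract X X' Y : is_retract X X' -> is_retract (X ⊗ Y) (X' ⊗ Y).
Proof.
move=> [i [r ri]]; exists (i ⊗m idm Y), (r ⊗m idm Y).
by rewrite -tensm_comp ri comp_idl tensm_id.
Qed.

Lemma tens_zero X Y : is_zero X -> is_zero (X ⊗ Y).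
Proof.
rewrite /is_zero -tensm_id => ->.
by apply: (addrI ((0 : hom X X) ⊗m idm Y)); rewrite -tensmDl !addr0.
Qed.

Lemma tt_ideal_iso J X Y : tt_ideal J -> isomorphic X Y -> J X -> J Y.
Proof. by move=> [_ [tJ _] _]; exact: triangulated_sub_iso. Qed.

(** The quotient ideal (J : b). *)
Definition colon J b : set T := [set x | compact_ob x /\ J (x ⊗ b)].

Lemma tt_ideal_colon J b : tt_ideal J -> tt_ideal (colon J b).
Proof.
move=> iJ; have [Jc [[J0 JS JC] JR] JM] := iJ.
have [[c0 cS cC] cR] := compact_ob_thick T.
split=> [x []//||a p ca [cp Jp]]; last first.
  split; first exact: big_tens_compact.
  by apply: tt_ideal_iso (isomorphic_sym (tens_isoA _ _ _)) (JM _ _ ca Jp).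
split; last first.
  move=> X Y YX [cX JX]; split; first exact: cR YX cX.
  by apply: JR JX; exact: tens_retract.
split=> [Z Z0|X|X Y Z f g h d [cX JX] [cY JY]].
- by split; [exact: c0|apply: J0; exact: tens_zero].
- have e : isomorphic (susp X ⊗ b) (susp (X ⊗ b)).
    by exists (tsusp X b); exact: tsusp_iso.
  split=> -[/cS cX JX]; split=> //.
    by apply/JS; exact: tt_ideal_iso e JX.
  by apply: tt_ideal_iso (isomorphic_sym e) _ => //; apply/JS.
- by split; [exact: cC d cX cY|exact: JC (tens_exact b d) JX JY].
Qed.

Lemma sub_colon J b : tt_ideal J -> compact_ob b -> J `<=` colon J b.
Proof.
move=> iJ cb x Jx; have [Jc _ JM] := iJ; split; first exact: Jc.
exact: tt_ideal_iso (tens_isoC _ _) (JM _ _ cb Jx).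
Qed.

(** Rigidity makes every ideal radical: t is a retract of t ⊗ t^∨ ⊗ t. *)
Lemma tt_ideal_radical J t : tt_ideal J -> compact_ob t -> J (t ⊗ t) -> J t.
Proof.
move=> iJ ct Jtt; have [_ [_ JR] JM] := iJ.
have [t' ct' [ev [coev [zigzag _]]]] := big_rigid ct.
have [l [lK Kl]] := lunit_iso t.
apply: (JR (t ⊗ t' ⊗ t)).
  exists ((coev ⊗m idm t) ∘ l), (runit t ∘ (idm t ⊗m ev) ∘ tassoc t t' t).
  by rewrite compA zigzag.
apply: tt_ideal_iso (JM _ _ ct' Jtt) => //.
apply: isomorphic_trans (isomorphic_sym (tens_isoA _ _ _)) _.
by apply: tens_iso; exact: tens_isoC.
Qed.

Lemma tt_ideal_bigcup (F : set (set T)) :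
  F !=set0 -> (forall J, F J -> tt_ideal J) -> total_on F subset ->
  tt_ideal (\bigcup_(J in F) J).
Proof.
move=> [J0 FJ0] iF tF.
have dir J K X Y : F J -> F K -> J X -> K Y -> exists L, [/\ F L, L X & L Y].
  by move=> FJ FK JX KY; have [/(_ _ JX)|/(_ _ KY)] := tF _ _ FJ FK;
    [exists K|exists J].
split=> [X [J FJ JX]||a p ca [J FJ Jp]].
- by have [+ _ _] := iF _ FJ; apply.
- split; last first.
    move=> X Y YX [J FJ JX]; exists J => //.
    by have [_ [_ JR] _] := iF _ FJ; exact: JR YX JX.
  split=> [Z Z0|X|X Y Z f g h d [J FJ JX] [K FK KY]].
  + by exists J0 => //; have [_ [[+ _ _] _] _] := iF _ FJ0; apply.
  + by split=> -[J FJ JX]; exists J => //;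
      have [_ [[_ JS _] _] _] := iF _ FJ; apply/JS.
  + have [L [FL LX LY]] := dir _ _ _ _ FJ FK JX KY; exists L => //.
    by have [_ [[_ _ LC] _] _] := iF _ FL; exact: LC d LX LY.
- by exists J => //; have [_ _ JM] := iF _ FJ; exact: JM.
Qed.

(** A maximal ideal among those that miss t is prime: if it contains a ⊗ b
    but neither factor, then maximality puts t into (J : b), then b into
    (J : t) puts t there too, so that t ⊗ t and hence t lie in J. *)
Lemma prime_avoiding J t : tt_ideal J -> compact_ob t -> ~ J t ->
  exists2 Q : Spc T, J `<=` Q & ~ (Q : set T) t.
Proof.
move=> iJ ct Jt.
have [//|F F0 FP tF|M [[iM Mt] JM Mmax]] :=
  @Zorn_above T [set K | tt_ideal K /\ ~ K t] J.
  split; first by apply: tt_ideal_bigcup => // K /FP[].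
  by move=> [K /FP[_ +] Kt]; apply.
have colon_t b x : compact_ob b -> M (x ⊗ b) -> compact_ob x -> ~ M x -> M (t ⊗ b).
  move=> cb Mxb cx Mx; apply: contrapT => ntb; apply: Mx.
  apply: (Mmax (colon M b)) => //; last exact: sub_colon.
  by split; [exact: tt_ideal_colon|case].
have Mp : is_tt_prime M.
  have [Mc Mthick MM] := iM; split=> //; first by exists t.
  move=> a b ca cb Mab; apply: contrapT => /not_orP[nMa nMb]; apply: Mt.
  apply: tt_ideal_radical => //; apply: (colon_t _ b) => //.
  by apply: (tt_ideal_iso iM (tens_isoC _ _)); exact: (colon_t _ a).
by exists (MkSpc Mp).
Qed.

End Ideals.

(** * Prime ideals and the Zariski topology *)

Section RingPrime.
Context (R : comPzRingType).

Definition ring_ideal (I : set R) :=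
  [/\ I 0, forall a b, I a -> I b -> I (a + b) & forall a b, I b -> I (a * b)].

(** A maximal ideal among those that miss all powers of s is prime. *)
Lemma ring_prime_avoiding (I : set R) (s : R) :
  ring_ideal I -> (forall n, ~ I (s ^+ n)) ->
  exists2 p : Spec R, I `<=` p & ~ (p : set R) s.
Proof.
move=> iI Is.
have [//|F [J0 FJ0] FP tF|M [[[M0 MD MM] Ms] IM Mmax]] :=
  @Zorn_above R [set K | ring_ideal K /\ forall n, ~ K (s ^+ n)] I.
  split; last by move=> n [K /FP[_ Ks] /Ks].
  split=> [|a b [J FJ Ja] [K FK Kb]|a b [J FJ Jb]].
  - by exists J0 => //; have [[]] := FP _ FJ0.
  - have [JK|KJ] := tF _ _ FJ FK.
      by exists K => //; have [[_ + _] _] := FP _ FK; apply=> //; exact: JK.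
    by exists J => //; have [[_ + _] _] := FP _ FJ; apply=> //; exact: KJ.
  - by exists J => //; have [[_ _ +] _] := FP _ FJ; apply.
(* the colon ideal (M : b) properly contains M, hence contains a power of s *)
have pow b x : M (x * b) -> ~ M x -> exists n, M (s ^+ n * b).
  move=> Mxb Mx; apply: contrapT => nn; apply: Mx.
  apply: (Mmax [set y | M (y * b)]) => // [|y My]; last by rewrite /= mulrC; exact: MM.
  split; last by move=> n Mn; apply: nn; exists n.
  split=> [|c d cb db|c d db]; rewrite /= ?mul0r //.
  - by rewrite mulrDl; exact: MD.
  - by rewrite -mulrA; exact: MM.
have pM : is_prime_ideal M.
  split=> //; first by rewrite -(expr0 s).
  move=> a b Mab; apply: contrapT => /not_orP[nMa nMb].
  have [n Mn] := pow _ _ Mab nMa; rewrite mulrC in Mn.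
  by have [m] := pow _ _ Mn nMb; rewrite -exprD; exact: Ms.
by exists (MkSpec pM) => //=; rewrite -(expr1 s).
Qed.

Lemma basic_D_finite_inter (l : seq (set (Spec R))) :
  (forall A, A \in l -> range (@basic_D R) A) ->
  exists s, forall p, basic_D s p <-> forall A, A \in l -> A p.
Proof.
elim: l => [|A l IH] lD.
  by exists 1 => p; split=> // _; have [_ _ _ + _] := Spec_prime p.
have [|s sP] := IH; first by move=> B Bl; apply: lD; rewrite inE Bl orbT.
have [t _ tA] := lD A (mem_head _ _).
exists (t * s) => p; have [_ _ pM _ pP] := Spec_prime p; split=> [ts B|AB].
  rewrite inE => /orP[/eqP ->|Bl].
    by rewrite -tA => pt; apply: ts; rewrite mulrC; exact: pM.
  by move: B Bl; apply/sP => ps; apply: ts; exact: pM.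
case/pP => [pt|ps].
  by have := AB A (mem_head _ _); rewrite -tA; apply.
have : basic_D s p by apply/sP => B Bl; apply: AB; rewrite inE Bl orbT.
by apply.
Qed.

Lemma Spec_basis (V : set (Spec R)) (p : Spec R) :
  open V -> V p -> exists2 s, basic_D s p & basic_D s `<=` V.
Proof.
move=> oV Vp.
have [D DI VE] : [set \bigcup_(A in D') id A |
  D' in subset^~ (finI_from (range (@basic_D R)) id)] V := oV.
move: Vp; rewrite -VE => -[A DA Ap].
have [E ED AE] := DI _ DA.
have [l|s sP] := @basic_D_finite_inter (enum_fset E).
  by move=> lE; have := ED _ lE; rewrite in_setE.
exists s; first by apply/sP => B BE; move: Ap; rewrite -AE; apply.
by move=> q /sP qE; exists A => //=; rewrite -AE => B /= BE; exact: qE.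
Qed.

Lemma open_basic_D (s : R) : open (basic_D s).
Proof.
exists [set basic_D s]; last by rewrite bigcup_set1.
move=> _ ->; exists [fset (basic_D s)]%fset.
  by move=> A; rewrite inE => /eqP ->; apply/mem_set; exists s.
apply/seteqP; split=> [p pI|p sp A /=]; last by rewrite inE => /eqP ->.
by apply: (pI (basic_D s)); rewrite /= inE.
Qed.

End RingPrime.

Lemma open_basic_U (T : tensor_triangulated) (a : T) :
  compact_ob a -> open (basic_U a).
Proof.
move=> ca; exists [set basic_U a]; last by rewrite bigcup_set1.
move=> _ ->; exists [fset (basic_U a)]%fset.
  by move=> A; rewrite inE => /eqP ->; apply/mem_set; exists a.
apply/seteqP; split=> [p pI|p sp A /=]; last by rewrite inE => /eqP ->.
by apply: (pI (basic_U a)); rewrite /= inE.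
Qed.

(** * The spectrum of an affine category *)

Section Affine.
Context (T : big_tt_category) (aff : affine T).
Notation R := (unit_end T).
Implicit Types (P Q : Spc T) (r s : R) (t : T).

Lemma rho_prime P : is_prime_ideal (rho P).
Proof. by have [r [rE _ _ _ _]] := aff; rewrite -rE; exact: Spec_prime. Qed.

Lemma rho_surj (p : Spec R) : exists P, rho P = p.
Proof.
by have [r [rE [k _ kK] _ _ _]] := aff; exists (k p); rewrite -rE kK.
Qed.

Lemma rhoP s P : rho_opens s P <-> ~ rho P s.
Proof. by split=> [sP nsP|nsP]; [exact: (nsP sP)|exact: (contrapT nsP)]. Qed.

Lemma rho_opens1 : rho_opens (1 : R) = setT.
Proof.
by apply/seteqP; split=> // P _; apply/rhoP; have [_ _ _ + _] := rho_prime P.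
Qed.

Lemma rho_opensM r s : rho_opens (r * s) = rho_opens r `&` rho_opens s.
Proof.
apply/seteqP; split=> [P /rhoP rs|P [/rhoP Pr /rhoP Ps]]; last first.
  by apply/rhoP; have [_ _ _ _ Pp] := rho_prime P => /Pp[].
have [_ _ PM _ _] := rho_prime P.
by split; apply/rhoP => ?; apply: rs; [rewrite mulrC|]; exact: PM.
Qed.

Lemma rho_opens_compact s P : rho_opens s P -> compact_ob (cone s).
Proof. by have [Pc _ _ _ _] := Spc_prime P; exact: Pc. Qed.

Lemma open_rho_opens s : open (rho_opens s).
Proof.
have [r [rE _ /continuousP rc _ _]] := aff.
rewrite (_ : rho_opens s = r @^-1` (basic_D s)).
  by apply: rc; exact: open_basic_D.
by apply/seteqP; split=> P /=; rewrite /basic_D /= rE => /rhoP.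
Qed.

Lemma rho_opens_basis (V : set (Spc T)) P :
  open V -> V P -> exists2 s, rho_opens s P & rho_opens s `<=` V.
Proof.
move=> oV VP; have [r [rE [k kr rk] _ ro _]] := aff.
have [|s sP sV] := Spec_basis (ro _ oV) (p := r P); first by exists P.
exists s; first by apply/rhoP; rewrite -rE.
move=> Q /rhoP; rewrite -rE => /sV[Q' VQ' /(congr1 k)].
by rewrite !kr => <-.
Qed.

(** The f whose U(cone f) is disjoint from some member of a given proper filter
    form an ideal. If the filter contains U(cone s), then no power of s
    lies in it, and a prime above it that avoids s is a cluster point. *)
Lemma compact_rho_opens s : compact (rho_opens s).
Proof.
move=> F FF Fs.
pose I : set R := [set f | exists2 A, F A & A `&` rho_opens f = set0].
have iI : ring_ideal I.
  split=> [|f g [A FA Af] [B FB Bg]|f g [A FA Ag]].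
  - exists setT; first exact: filterT.
    apply/seteqP; split=> // P [_ /rhoP]; apply.
    by have [] := rho_prime P.
  - exists (A `&` B); first exact: filterI.
    apply/seteqP; split=> // P [[AP BP] /rhoP fg].
    have [_ PD _ _ _] := rho_prime P.
    have [Pf|/rhoP Pf] := pselect (rho P f); last by rewrite -Af.
    have [Pg|/rhoP Pg] := pselect (rho P g); last by rewrite -Bg.
    by apply: fg; exact: PD.
  - exists A => //; apply/seteqP; split=> // P [AP].
    by rewrite rho_opensM => -[_ Pg]; rewrite -Ag.
have Is n : ~ I (s ^+ n).
  move=> [A FA].
  have sub : rho_opens s `<=` rho_opens (s ^+ n).
    elim: n => [|n IH] P Ps; first by rewrite expr0 rho_opens1.
    by rewrite exprS rho_opensM; split=> //; exact: IH.
  move=> A0; apply: (filter_not_empty F).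
  have <- : A `&` rho_opens s = set0.
    by apply/seteqP; split=> // P [AP /sub sP]; rewrite -A0.
  exact: filterI.
have [p Ip ps] := ring_prime_avoiding iI Is.
have [P Pp] := rho_surj p; exists P; split; first by apply/rhoP; rewrite Pp.
move=> A B FA /nbhs_interior; rewrite nbhsE => -[V [oV VP] VB].
have [f Pf fV] := rho_opens_basis oV VP.
apply: contrapT => AB; move/rhoP: Pf; apply; rewrite Pp; apply: Ip.
exists A => //; apply/seteqP; split=> // Q [AQ /fV/VB/interior_subset BQ].
by apply: AB; exists Q.
Qed.

Lemma qcopen_rho_opens s : qcopen (Spc T) (rho_opens s).
Proof. by split; [exact: open_rho_opens|exact: compact_rho_opens]. Qed.

(** For t in P, the open set U(t) contains a basic neighbourhood of P, the
    preimage under rho of some D(s); as s avoids rho P, it avoids rho Q. *)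
Lemma rho_reflects_order P Q : rho Q `<=` rho P -> (P : set T) `<=` Q.
Proof.
move=> QP t Pt; have [Pc _ _ _ _] := Spc_prime P.
have [s /rhoP Ps sU] := rho_opens_basis (open_basic_U (Pc _ Pt)) Pt.
by apply: sU; apply/rhoP => /QP.
Qed.

(** * Objects of a prime are torsion *)

Definition annihilated P : set T :=
  [set t | compact_ob t /\ exists2 s, rho_opens s P & act s t = 0].

Lemma tt_ideal_annihilated P : tt_ideal (annihilated P).
Proof.
have [[c0 cS cC] cR] := compact_ob_thick T.
split=> [t []//||a t ca [ct [s Ps st]]]; last first.
  by split; [exact: big_tens_compact|exists s => //; exact: act0_tens].
split; last first.
  move=> X Y YX [cX [s Ps sX]]; split; first exact: cR YX cX.
  by exists s => //; exact: act0_retract YX sX.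
split=> [Z Z0|X|X Y Z f g h d [cX [r Pr rX]] [cY [s Ps sY]]].
- split; first exact: c0.
  by exists 1; [rewrite rho_opens1|rewrite (is_zero_hom (act 1 Z))].
- split=> -[/cS cX [s Ps sX]]; split=> //; exists s => //.
    by apply: suspm_inj; rewrite -act_susp sX suspm0.
  by rewrite act_susp sX suspm0.
- split; first exact: cC d cX cY.
  exists (s * r); first by rewrite rho_opensM.
  by apply: act0_cone d _ _; rewrite ?sY ?compm0 // act_susp rX suspm0 comp0m.
Qed.

(** The annihilated objects form an ideal whose only prime overideals are
    those Q with rho Q contained in rho P, hence with P contained in Q; so
    no prime above it can miss an object of P. *)
Lemma prime_annihilated P t : (P : set T) t -> annihilated P t.
Proof.
move=> Pt; have [Pc _ _ _ _] := Spc_prime P; apply: contrapT => nt.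
have [Q aQ] := prime_avoiding (tt_ideal_annihilated P) (Pc _ Pt) nt.
apply; apply: rho_reflects_order Pt => s Qs Ps; apply: Qs; apply: aQ.
split; first exact: rho_opens_compact Ps.
by exists (s * s); [rewrite rho_opensM|exact: act0_cone_sqr].
Qed.

(** A map that vanishes in the localisation at rho P. *)
Definition torsion_map P (C W : T) (f : hom C W) :=
  exists2 s, rho_opens s P & f ∘ act s C = 0.

Lemma torsion_map_compl P C W W' (g : hom W W') (f : hom C W) :
  torsion_map P f -> torsion_map P (g ∘ f).
Proof. by move=> [s Ps fs]; exists s => //; rewrite -compA fs compm0. Qed.

Lemma torsion_map_compr P C C' W (f : hom C W) (g : hom C' C) :
  torsion_map P f -> torsion_map P (f ∘ g).
Proof. by move=> [s Ps fs]; exists s => //; rewrite -compA -act_nat compA fs comp0m. Qed.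

Lemma torsion_map_susp P C W (f : hom C W) :
  torsion_map P (suspm f) <-> torsion_map P f.
Proof.
split=> -[s Ps fs]; exists s => //; last by rewrite act_susp -suspm_comp fs suspm0.
by apply: suspm_inj; rewrite suspm_comp -act_susp fs suspm0.
Qed.

Lemma torsion_map_sum P C W I (l : seq I) (f : I -> hom C W) :
  (forall i, torsion_map P (f i)) -> torsion_map P (\sum_(i <- l) f i).
Proof.
move=> fP; elim: l => [|i l [s Ps fs]].
  by rewrite big_nil; exists 1; rewrite ?rho_opens1 ?comp0m.
have [r Pr fr] := fP i; exists (r * s); first by rewrite rho_opensM.
rewrite big_cons compDl act_mul compA fr comp0m add0r.
by rewrite -act_mul mulrC act_mul compA fs comp0m.
Qed.

Definition locally_torsion P : set T :=
  [set W | forall C (f : hom C W), compact_ob C -> torsion_map P f].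

(** For a triangle X -> Y -> Z -> ΣX and k : C -> Z, some r kills the image of k
    in ΣX, so k ∘ r lifts to Y, where some s kills the lift. For a coproduct, C
    being compact, finitely many denominators suffice. *)
Lemma localising_locally_torsion P : localising_sub (locally_torsion P).
Proof.
split; last first.
  move=> I F S inj cp FP C f cC; have [l [g ->]] := cC _ _ _ _ cp f.
  by apply: torsion_map_sum => i; apply: torsion_map_compl; exact: FP.
split=> [Z Z0 C f cC|X|X Y Z f g h d XP YP C k cC].
- by exists 1; [rewrite rho_opens1|rewrite (is_zero_hom f Z0) comp0m].
- split=> XP C f cC.
    by apply/torsion_map_susp; apply: XP; exact/compact_ob_susp.
  have [u [u' [_ uu']]] := susp_desusp C.
  rewrite -[f]comp_idr -uu' compA; apply: torsion_map_compr.
  have [f' <-] := suspm_surj (f ∘ u).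
  by apply/torsion_map_susp; apply: XP; exact: compact_ob_desusp.
- have [r Pr hr] : torsion_map P (h ∘ k).
    have [u [u' [_ uu']]] := susp_desusp C.
    rewrite -[h ∘ k]comp_idr -uu' compA; apply: torsion_map_compr.
    have [k' <-] := suspm_surj (h ∘ k ∘ u).
    by apply/torsion_map_susp; apply: XP; exact: compact_ob_desusp.
  have [k' kE] := dist_lift_rot d (etrans (compA _ _ _) hr).
  have [s Ps ks] := YP _ k' cC.
  exists (r * s); first by rewrite rho_opensM.
  by rewrite act_mul compA kE -compA ks compm0.
Qed.

(** The generators t of the kernel are compact and vanish on U, hence belong to
    P and are annihilated by a denominator. *)
Lemma ker_at_locally_torsion (U : set (Spc T)) P :
  U P -> ker_at U `<=` locally_torsion P.
Proof.
move=> UP W; apply; first exact: localising_locally_torsion.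
move=> t [ct tU] C f cC.
have /prime_annihilated[_ [s Ps st]] : (P : set T) t by apply: contrapT => /tU.
by exists s => //; rewrite -act_nat st comp0m.
Qed.

End Affine.

(** * Stalks *)

Lemma gen_eq_ind A (r : A -> A -> Prop) (e : A -> A -> Prop) :
  (forall a, e a a) -> (forall a b, e a b -> e b a) ->
  (forall a b c, e a b -> e b c -> e a c) ->
  (forall a b, r a b -> e a b) ->
  forall a b, cls r a = cls r b -> e a b.
Proof.
move=> e_refl e_sym e_trans re a b /clsP; elim=> //.
- by move=> x y _; exact: e_sym.
- by move=> x y z _ + _; exact: e_trans.
Qed.

Section StalkTheory.
Context (X : topologicalType) (B : set (set X)) (F : presheaf X).
Context (Bopen : B `<=` open)
  (Bbasis : forall (O : set X) x, open O -> O x -> exists W, [/\ B W, W x & W `<=` O]).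

Lemma germ_res (U V : set X) (h : V `<=` U) x (BU : B U) (Ux : U x)
    (BV : B V) (Vx : V x) (a : F U) :
  germ BU Ux a = germ BV Vx (pres h a).
Proof. by apply/clsP; apply: Relation_Operators.rst_step; exists h. Qed.

(** On a basis, neighbourhoods of x are cofiltered, so the equivalence generated
    by restriction amounts to equality on a smaller neighbourhood. *)
Lemma germ_eqP (U V : set X) x (BU : B U) (Ux : U x) (BV : B V) (Vx : V x)
    (a : F U) (b : F V) :
  germ BU Ux a = germ BV Vx b <->
  exists (W : set X) (h : W `<=` U) (h' : W `<=` V),
    [/\ B W, W x & pres h a = pres h' b].
Proof.
split=> [|[W [h [h' [BW Wx ab]]]]]; last first.
  by rewrite (germ_res h BU Ux BW Wx) (germ_res h' BV Vx BW Wx) ab.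
pose e (g g' : germ_rep B F x) := exists (W : set X)
  (h : W `<=` gr_set g) (h' : W `<=` gr_set g'),
  [/\ B W, W x & pres h (gr_sec g) = pres h' (gr_sec g')].
apply: (@gen_eq_ind _ _ e) => [g|g g'|g1 g2 g3|g g' [h gE]].
- by exists (gr_set g), (fun=> id), (fun=> id); split; [exact: gr_base|exact: gr_mem|].
- by move=> [W [h [h' [BW Wx gE]]]]; exists W, h', h.
- move=> [W [h1 [h2 [BW Wx E]]]] [W' [h2' [h3 [BW' Wx' E']]]].
  have [|//|W2 [BW2 W2x W2W]] := @Bbasis (W `&` W') x.
    by apply: openI; exact: Bopen.
  have i1 : W2 `<=` W by move=> y /W2W[].
  have i2 : W2 `<=` W' by move=> y /W2W[].
  exists W2, (fun y W2y => h1 y (i1 y W2y)), (fun y W2y => h3 y (i2 y W2y)).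
  split=> //.
  rewrite -(pres_comp h1 i1) E -(pres_comp h3 i2) -E'.
  have h2'' : W2 `<=` gr_set g2 by move=> y /i1/h2.
  by rewrite (pres_comp h2 i1 h2'') (pres_comp h2' i2 h2'').
- exists (gr_set g'), h, (fun=> id); split; [exact: gr_base|exact: gr_mem|].
  by rewrite pres_id.
Qed.

Lemma germP x (c : stalk B F x) :
  exists (U : set X) (BU : B U) (Ux : U x) (a : F U), c = germ BU Ux a.
Proof.
by rewrite -(qreprK c); case: (qrepr c) => U BU Ux a; exists U, BU, Ux, a.
Qed.

End StalkTheory.

Definition nontrivial A := exists a b : A, a <> b.

Section SheafifyStalk.
Context (X : topologicalType) (B : set (set X)) (F : presheaf X).
Context (Bopen : B `<=` open)
  (Bbasis : forall (O : set X) x, open O -> O x -> exists W, [/\ B W, W x & W `<=` O]).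

Let open_basis (O : set X) (x : X) : open O -> O x ->
  exists W, [/\ open W, W x & W `<=` O].
Proof. by move=> oO Ox; exists O; split. Qed.

(** Evaluation at x is a bijection from the stalk of the sheaf of families of
    germs to the stalk of the presheaf. *)
Lemma sheafify_stalk x :
  nontrivial (stalk open (sheafify B F) x) <-> nontrivial (stalk B F x).
Proof.
split.
  apply: contraPP => triv [a [b]]; apply.
  have {}triv (c d : stalk B F x) : c = d.
    by apply: contrapT => cd; apply: triv; exists c, d.
  have [U [oU [Ux [sigma ->]]]] := germP a.
  have [V [oV [Vx [tau ->]]]] := germP b.
  have [U' [BU' [c [U'x cE]]]] := svalP sigma x Ux.
  have [V' [BV' [d [V'x dE]]]] := svalP tau x Vx.
  have /(germ_eqP Bopen Bbasis)[W [h [h' [BW Wx cd]]]] :=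
    triv (germ BU' U'x c) (germ BV' V'x d).
  have [|//|W' [BW' W'x W'W]] := @Bbasis (W `&` (U `&` V)) x.
    by apply: openI; [exact: Bopen|exact: openI].
  have iW : W' `<=` W by move=> y /W'W[].
  have iU : W' `<=` U by move=> y /W'W[_ []].
  have iV : W' `<=` V by move=> y /W'W[_ []].
  apply/(germ_eqP (@subset_refl _ _) open_basis).
  exists W', iU, iV; split=> //; first exact: Bopen.
  apply: sig_eq => /=; apply: functional_extensionality_dep => y.
  apply: functional_extensionality_dep => W'y.
  rewrite (cE y (iU y W'y) (h y (iW y W'y))) (dE y (iV y W'y) (h' y (iW y W'y))).
  rewrite (germ_res h _ _ BW (iW y W'y)) cd.
  by rewrite -(germ_res h' BV' (h' y (iW y W'y))).
move=> [c [d cd]].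
have [U [BU [Ux [a aE]]]] := germP c; have [V [BV [Vx [b bE]]]] := germP d.
have secP (W : set X) (BW : B W) (e : F W) : exists sigma : shsec B F W,
    forall y (Wy : W y), sval sigma y Wy = germ BW Wy e.
  suff P y : W y -> exists (V : set X) (BV : B V) (a : F V), V y /\
      forall z (Wz : W z) (Vz : V z), germ BW Wz e = germ BV Vz a.
    by exists (exist _ (fun z Wz => germ BW Wz e) P).
  move=> Wy; exists W, BW, e; split=> // z Wz Wz'.
  by congr (germ _ _ _); exact: Prop_irrelevance.
have [sigma sE] := secP U BU a; have [tau tE] := secP V BV b.
exists (germ (F := sheafify B F) (Bopen BU) Ux sigma).
exists (germ (F := sheafify B F) (Bopen BV) Vx tau).
move=> /(germ_eqP (@subset_refl _ _) open_basis)[W [h [h' [oW Wx]]]].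
move=> /(congr1 sval) /= /(congr1 (fun k => k x Wx)); rewrite sE tE => st.
apply: cd; rewrite aE bE.
by rewrite (Prop_irrelevance Ux (h x Wx)) (Prop_irrelevance Vx (h' x Wx)).
Qed.

End SheafifyStalk.

(** * Supports as torsion loci *)

Section Supports.
Context (T : big_tt_category) (aff : affine T).
Notation R := (unit_end T).
Implicit Types (P : Spc T) (r s : R) (X : T) (U V : set (Spc T)).

Lemma qcopen_basis U P :
  open U -> U P -> exists V, [/\ qcopen (Spc T) V, V P & V `<=` U].
Proof.
move=> oU UP; have [s sP sU] := rho_opens_basis aff oU UP.
by exists (rho_opens s); split=> //; exact: qcopen_rho_opens.
Qed.

Lemma qcopen_open : qcopen (Spc T) `<=` open.
Proof. by move=> U []. Qed.

Lemma qcopenT : qcopen (Spc T) setT.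
Proof. by rewrite -(rho_opens1 aff); exact: qcopen_rho_opens. Qed.

Lemma torsion_map_unit P X (f : hom 𝟙 X) :
  torsion_map P f <-> exists2 s : R, rho_opens s P & f ∘ s = 0.
Proof. by split=> -[s Ps fs]; exists s => //; rewrite ?act_unit // -(act_unit s). Qed.

(** The map from 𝟙 to the cone of den is torsion: this is Ore's condition for
    replacing the denominator den by an element of R. *)
Lemma lift_to_apex P U A (den : hom A 𝟙) :
  U P -> inverted (ker_at U) den ->
  exists (s : R) (k : hom 𝟙 A), rho_opens s P /\ den ∘ k = s.
Proof.
move=> UP [Z [g [h [d LZ]]]].
have /torsion_map_unit[s Ps gs] :=
  ker_at_locally_torsion aff UP LZ g (@big_unit_compact T).
by have [k kE] := dist_lift d gs; exists s, k.
Qed.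

(** Σk factors through the cone of den, which is locally torsion. *)
Lemma torsion_of_den P U A (den : hom A 𝟙) (k : hom 𝟙 A) :
  U P -> inverted (ker_at U) den -> den ∘ k = 0 -> torsion_map P k.
Proof.
move=> UP [Z [g [h [d LZ]]]] dk; apply/torsion_map_susp.
have [|w ->] := dist_lift_rot2 d (u := suspm k).
  by rewrite -suspm_comp dk suspm0.
apply: torsion_map_compl; apply: (ker_at_locally_torsion aff UP LZ).
by apply/compact_ob_susp; exact: big_unit_compact.
Qed.

(** The fraction num ∘ den^-1 vanishes near P as soon as this holds. *)
Definition torsion_roof P U X (x : roof (ker_at U) 𝟙 X) :=
  exists (s : R) (k : hom 𝟙 (apex x)),
    [/\ rho_opens s P, den x ∘ k = s & num x ∘ k = 0].

(** Both lifts of denominators, t ∘ k' ∘ s and k ∘ s', have the same image s * s'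
    under den, so they agree after multiplication by a further r. *)
Lemma torsion_roof_step P U X (x y : roof (ker_at U) 𝟙 X) :
  U P -> roof_step x y -> torsion_roof P x <-> torsion_roof P y.
Proof.
move=> UP [t [dE nE]]; split=> [[s [k [Ps dk nk]]]|[s [k [Ps dk nk]]]]; last first.
  by exists s, (t ∘ k); rewrite !compA -dE -nE.
have [s' [k' [Ps' dk']]] := lift_to_apex UP (den_inverted y).
have /torsion_map_unit[r Pr rE] : torsion_map P (t ∘ k' ∘ s - k ∘ s').
  apply: (torsion_of_den UP (den_inverted x)).
  rewrite compBr !compA -dE dk dk'; apply/eqP; rewrite subr_eq0; apply/eqP.
  exact: (mulrC (s' : R) s).
exists (s' * (s * r)), (k' ∘ s ∘ r); split.
- by rewrite !(rho_opensM aff).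
- by rewrite !compA dk' -!compA.
- move: rE; rewrite compBl => /eqP; rewrite subr_eq0 => /eqP rE.
  by rewrite nE -!compA (compA t) (compA _ s) rE !compA nk !comp0m.
Qed.

Lemma torsion_roof_cls P U X (x y : roof (ker_at U) 𝟙 X) :
  U P -> cls (@roof_step _ _ _ _) x = cls (@roof_step _ _ _ _) y ->
  torsion_roof P x -> torsion_roof P y.
Proof.
move=> UP xy; suff [] : torsion_roof P x <-> torsion_roof P y by [].
move: x y xy; apply: gen_eq_ind => [x|x y []|x y z [xy yx] [yz zy]|x y] //.
  by split=> [/xy|/zy].
exact: torsion_roof_step.
Qed.

Lemma vloc_eq0 P U X (f : hom 𝟙 X) :
  U P -> vloc (ker_at_triangulated U) f = homat0 X U -> torsion_map P f.
Proof.
move=> UP /esym /(torsion_roof_cls UP)[|s [k [Ps]]] /=.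
  by exists 1, (idm _); rewrite (rho_opens1 aff) /= comp_idl comp0m.
by rewrite comp_idl => ->; rewrite torsion_map_unit; exists s.
Qed.

(** Rewrite the fraction with a denominator s in R; its numerator is killed by
    some r, and s * r becomes invertible on U(cone (s * r)). *)
Lemma homat_vanishes_near P U X (a : homat X U) :
  (forall f : hom 𝟙 X, torsion_map P f) -> U P ->
  exists2 s, rho_opens s P &
    forall V (VU : V `<=` U), V `<=` rho_opens s -> homat_res VU a = homat0 X V.
Proof.
move=> Xtors UP; rewrite -(qreprK a); case: (qrepr a) => A den num denU.
have [s [k [Ps dk]]] := lift_to_apex UP denU.
have /torsion_map_unit[r Pr rE] := Xtors (num ∘ k).
exists (s * r); first by rewrite (rho_opensM aff).
move=> V VU Vsr; rewrite /homat_res vres_cls /=.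
have srV : inverted (ker_at V) (s * r : hom 𝟙 𝟙).
  have [g [h d]] := svalP (cid (dist_cone (s * r : hom 𝟙 𝟙))).
  exists (cone (s * r : hom 𝟙 𝟙)), g, h; split=> // L LL; apply; split.
    by apply: (@rho_opens_compact _ _ P); rewrite (rho_opensM aff).
  by move=> Q nQ /Vsr.
(* both num ∘ den^-1 and 0 ∘ 1^-1 expand to the fraction 0 ∘ (sr)^-1 *)
pose z : roof (ker_at V) 𝟙 X := Roof (0 : hom 𝟙 X) srV.
have zE x : roof_step x z -> cls (@roof_step _ _ _ _) x = cls (@roof_step _ _ _ _) z.
  by move=> xz; apply/clsP; exact: Relation_Operators.rst_step.
apply: (@etrans _ _ (cls (@roof_step _ _ _ _) z)); [|apply: esym]; apply: zE.
  by exists (k ∘ r); rewrite /= !compA dk rE.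
by exists (s * r : hom 𝟙 𝟙); rewrite /= comp_idl comp0m.
Qed.

Lemma homat0_res U V (VU : V `<=` U) X : homat_res VU (homat0 X U) = homat0 X V.
Proof. exact: vres_vloc. Qed.

(** Any germ is that of the zero section if all maps are torsion; conversely a
    map whose germ is zero is torsion, by comparing fractions. *)
Lemma supp_torsion P X : supp X P <-> exists f : hom 𝟙 X, ~ torsion_map P f.
Proof.
rewrite /supp /sheaf_support /=.
have := sheafify_stalk (homsheaf X) qcopen_open qcopen_basis P.
rewrite /nontrivial => ->; split=> [[a [b ab]]|[f nf]].
  apply: contrapT => /forallNP Xtors; apply: ab.
  have {}Xtors (f : hom 𝟙 X) : torsion_map P f by exact: contrapT (Xtors f).
  suff E c : c = germ (F := homsheaf X) qcopenT (x := P) I (homat0 X setT).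
    by rewrite (E a) (E b).
  have [U [qU [UP [{}a ->]]]] := germP c.
  have [s Ps sP] := homat_vanishes_near a Xtors UP.
  have [|V [qV VP VUs]] := @qcopen_basis (U `&` rho_opens s) P _ (conj UP Ps).
    by apply: openI; [case: qU|exact: open_rho_opens].
  have VU : V `<=` U by move=> Q /VUs[].
  rewrite (germ_res VU qU UP qV VP) (germ_res (@subsetT _ V) qcopenT I qV VP) /=.
  rewrite (sP V VU) => [|Q /VUs[]] //.
  by rewrite homat0_res.
exists (germ (F := homsheaf X) qcopenT (x := P) I (vloc (ker_at_triangulated setT) f)).
exists (germ (F := homsheaf X) qcopenT (x := P) I (homat0 X setT)).
move=> /(germ_eqP qcopen_open qcopen_basis)[W [h [h' [_ WP]]]] /=.
by rewrite homat0_res /homat_res (vres_vloc _ (ker_at_triangulated W)) => /(vloc_eq0 WP).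
Qed.

Definition tw_homat0 X U : tw_homat X U.
Proof.
exists (fun i => homat0 (shift i X) U).
by apply: sub_finite_set (finite_set0 _) => i; apply.
Defined.

Definition tw_single X U (i : int) (a : homat (shift i X) U) : tw_homat X U.
Proof.
exists (dfwith (fun j => homat0 (shift j X) U) i a).
apply: sub_finite_set (finite_set1 i) => j /= ja; apply: contrapT => ji.
by apply: ja; rewrite dfwithout //; apply/eqP => ij; exact: ji.
Defined.

(** A section has finitely many nonzero components, so the finitely many
    neighbourhoods on which they vanish have a common refinement. *)
Lemma tw_homat_vanishes_near P U X (a : tw_homat X U) :
  (forall i (f : hom 𝟙 (shift i X)), torsion_map P f) -> U P ->
  exists2 s, rho_opens s P &
    forall V (VU : V `<=` U), V `<=` rho_opens s -> tw_res VU a = tw_homat0 X V.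
Proof.
move=> Xtors UP; have /finite_seqP[l lE] := svalP a.
suff [s Ps sP] : exists2 s : R, rho_opens s P &
    forall i, i \in l -> forall V (VU : V `<=` U), V `<=` rho_opens s ->
      homat_res VU (sval a i) = homat0 (shift i X) V.
  exists s => // V VU Vs; apply: sig_eq; apply: functional_extensionality_dep => i /=.
  have [il|nil] := boolP (i \in l); first exact: sP.
  have -> : sval a i = homat0 (shift i X) U.
    apply: contrapT => ai0; move/negP: nil; apply.
    by have : [set` l] i by rewrite -lE.
  exact: homat0_res.
elim: l {lE} => [|i l [s Ps sP]]; first by exists 1; rewrite ?(rho_opens1 aff).
have [r Pr rP] := homat_vanishes_near (sval a i) (Xtors i) UP.
exists (r * s); first by rewrite (rho_opensM aff).
move=> j; rewrite inE => /orP[/eqP ->|jl] V VU Vrs.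
  by apply: rP => Q /Vrs; rewrite (rho_opensM aff) => -[].
by apply: sP => // Q /Vrs; rewrite (rho_opensM aff) => -[].
Qed.

Lemma tw_supp_torsion P X :
  tw_supp X P <-> exists i (f : hom 𝟙 (shift i X)), ~ torsion_map P f.
Proof.
rewrite /tw_supp /sheaf_support /=.
have := sheafify_stalk (tw_homsheaf X) qcopen_open qcopen_basis P.
rewrite /nontrivial => ->; split=> [[a [b ab]]|[i [f nf]]].
  apply: contrapT => Xtors; apply: ab.
  have {}Xtors i (f : hom 𝟙 (shift i X)) : torsion_map P f.
    by apply: contrapT => nf; apply: Xtors; exists i, f.
  suff E c : c = germ (F := tw_homsheaf X) qcopenT (x := P) I (tw_homat0 X setT).
    by rewrite (E a) (E b).
  have [U [qU [UP [{}a ->]]]] := germP c.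
  have [s Ps sP] := tw_homat_vanishes_near a Xtors UP.
  have [|V [qV VP VUs]] := @qcopen_basis (U `&` rho_opens s) P _ (conj UP Ps).
    by apply: openI; [case: qU|exact: open_rho_opens].
  have VU : V `<=` U by move=> Q /VUs[].
  rewrite (germ_res VU qU UP qV VP) (germ_res (@subsetT _ V) qcopenT I qV VP) /=.
  rewrite (sP V VU) => [|Q /VUs[]] //; congr (germ _ _ _).
  by apply: sig_eq; apply: functional_extensionality_dep => i /=; rewrite homat0_res.
exists (germ (F := tw_homsheaf X) qcopenT (x := P) I
  (tw_single (vloc (ker_at_triangulated setT) f))).
exists (germ (F := tw_homsheaf X) qcopenT (x := P) I (tw_homat0 X setT)).
move=> /(germ_eqP qcopen_open qcopen_basis)[W [h [h' [_ WP]]]].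
move=> /(congr1 sval) /= /(congr1 (fun a => a i)).
rewrite dfwithin homat0_res /homat_res (vres_vloc _ (ker_at_triangulated W)).
by move=> /(vloc_eq0 WP).
Qed.

End Supports.

(** * Sequential homotopy colimits *)

Section Telescope.
Context (T : big_tt_category) (Y : nat -> T) (y : forall n, hom (Y n) (Y n.+1)).

Fixpoint transition (n : nat) : hom (Y 0%N) (Y n) :=
  if n is m.+1 then y m ∘ transition m else idm (Y 0%N).

Section Shift.
Context (S : T) (inj : forall n, hom (Y n) S) (cp : is_coproduct inj).
Context (sh : hom S S) (shE : forall n, sh ∘ inj n = inj n.+1 ∘ y n).

Lemma coproj_shift0 : coproj cp 0%N ∘ (idm S - sh) = coproj cp 0%N.
Proof.
rewrite compBr comp_idr (_ : _ ∘ sh = 0) ?subr0 //.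
by apply: (coproduct_ext cp) => n; rewrite -compA shE compA coproj_inj_neq ?comp0m.
Qed.

Lemma coproj_shiftS n :
  coproj cp n.+1 ∘ (idm S - sh) = coproj cp n.+1 - y n ∘ coproj cp n.
Proof.
rewrite compBr comp_idr; congr (_ - _).
apply: (coproduct_ext cp) => m; rewrite -!compA shE compA.
have [->|mn] := pselect (m = n); first by rewrite !coproj_inj comp_idl comp_idr.
by rewrite !coproj_inj_neq ?comp0m ?compm0 // => -[].
Qed.

(** The components p_n ∘ u satisfy p_0 ∘ u = 0 and p_(n+1) ∘ u = y_n ∘ p_n ∘ u,
    so all vanish, and u is determined by finitely many of them. *)
Lemma shift_mono C (u : hom C S) : compact_ob C -> (idm S - sh) ∘ u = 0 -> u = 0.
Proof.
move=> cC u0.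
have pu n : coproj cp n ∘ u = 0.
  elim: n => [|n IH]; first by rewrite -coproj_shift0 -compA u0 compm0.
  have := congr1 (fun v => coproj cp n.+1 ∘ v) u0.
  by rewrite compA coproj_shiftS compBl -compA IH !compm0 subr0.
have /(finitely_supportedP cp)[s sP] := cC _ _ _ _ cp u.
rewrite -(sP s) // /partial_id comp_suml big1 // => n _.
by rewrite -compA pu compm0.
Qed.

(** The components of v are the images of g in the terms of the sequence, and
    only finitely many of them are nonzero. *)
Lemma shift_preimage_inj0 C (g : hom C (Y 0%N)) (v : hom C S) :
  compact_ob C -> inj 0%N ∘ g = (idm S - sh) ∘ v -> exists n, transition n ∘ g = 0.
Proof.
move=> cC gv.
have pv n : coproj cp n ∘ v = transition n ∘ g.
  elim: n => [|n IH].
    by rewrite -coproj_shift0 -compA -gv compA coproj_inj.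
  have := congr1 (fun v => coproj cp n.+1 ∘ v) gv.
  rewrite [LHS]compA coproj_inj_neq // comp0m compA coproj_shiftS compBl -compA IH.
  by move/esym/eqP; rewrite subr_eq0 => /eqP ->; rewrite compA.
have /(finitely_supportedP cp)[s sP] := cC _ _ _ _ cp v.
have [n sn] : exists n : nat, forall i : nat, (i : {classic nat}) \in s -> (i < n)%N.
  elim: s {sP} => [|m s [n sn]]; first by exists 0%N.
  exists (maxn m.+1 n) => i; rewrite inE => /orP[/eqP ->|/sn]; rewrite leq_max ?leqnn //.
  by move=> ->; rewrite orbT.
exists n; rewrite -pv -(sP s) // /partial_id compA comp_sumr comp_suml.
rewrite (@big1_seq _ _ _ {classic nat}) // => i /andP[_]; rewrite mem_undup => /sn lin.
rewrite (compA (coproj cp n)) coproj_inj_neq ?comp0m // => ni.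
by rewrite ni ltnn in lin.
Qed.

End Shift.

(** The cone of 1 - shift on the coproduct: compact objects see it as the
    colimit of the sequence. *)
Lemma telescope : exists (B : T) (q : forall n, hom (Y n) B),
  [/\ forall n, q n.+1 ∘ y n = q n,
      forall C (f : hom C B), compact_ob C -> exists n (g : hom C (Y n)), f = q n ∘ g &
      forall C (g : hom C (Y 0%N)), compact_ob C -> q 0%N ∘ g = 0 ->
        exists n, transition n ∘ g = 0].
Proof.
have [S [inj cp]] := big_coprod Y.
have [sh [shE _]] := cp S (fun n => inj n.+1 ∘ y n).
have [B [p [h d]]] := dist_cone (idm S - sh).
have qE n : p ∘ inj n.+1 ∘ y n = p ∘ inj n.
  have := congr1 (fun k => k ∘ inj n) (dist_comp0 d).
  rewrite /= comp0m -compA compBl comp_idl shE compBr => /eqP.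
  by rewrite subr_eq0 => /eqP ->; rewrite compA.
have push m n : (m <= n)%N ->
    exists t : hom (Y m) (Y n), p ∘ inj n ∘ t = p ∘ inj m.
  elim: n => [|n IH]; first by rewrite leqn0 => /eqP ->; exists (idm _); rewrite comp_idr.
  rewrite leq_eqVlt => /orP[/eqP ->|/IH[t tE]]; first by exists (idm _); rewrite comp_idr.
  by exists (y n ∘ t); rewrite compA qE.
exists B, (fun n => p ∘ inj n); split=> // [C f cC|C g cC qg].
  have hf : h ∘ f = 0.
    have [u [u' [_ uu']]] := susp_desusp C.
    suff : h ∘ f ∘ u = 0 by move=> hfu; rewrite -[LHS]comp_idr -uu' compA hfu comp0m.
    have [v vE] := suspm_surj (h ∘ f ∘ u); rewrite -vE.
    suff -> : v = 0 by exact: suspm0.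
    apply: (shift_mono cp shE (compact_ob_desusp cC)); apply: suspm_inj.
    by rewrite suspm_comp vE suspm0 !compA (dist_comp0_rot2 d) !comp0m.
  have [f' ->] := dist_lift_rot d hf.
  have [s [g ->]] := cC _ _ _ _ cp f'.
  elim: s => [|i s [n [k kE]]].
    by exists 0%N, 0; rewrite big_nil !compm0.
  have [t tE] := push _ _ (leq_maxl i n); have [t' tE'] := push _ _ (leq_maxr i n).
  exists (maxn i n), (t ∘ g i + t' ∘ k).
  by rewrite big_cons compDr kE compDr !compA tE tE'.
have [|v vE] := dist_lift d (u := inj 0%N ∘ g); first by rewrite compA.
exact: (shift_preimage_inj0 cp shE cC vE).
Qed.

End Telescope.

(** * Truncation triangles *)

Section Orthogonality.
Context (T : triangulated).
Implicit Types (A X : T) (i j n : int).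

Definition no_maps A X := forall f : hom A X, f = 0.

Lemma no_maps_isol A A' X : isomorphic A A' -> no_maps A X -> no_maps A' X.
Proof.
by move=> [f [g [_ fg]]] AX k; rewrite -[k]comp_idr -fg compA (AX (k ∘ f)) comp0m.
Qed.

Lemma no_maps_isor A X X' : isomorphic X X' -> no_maps A X -> no_maps A X'.
Proof.
by move=> [f [g [_ fg]]] AX k; rewrite -[k]comp_idl -fg -compA (AX (g ∘ k)) compm0.
Qed.

Lemma no_maps_susp A X : no_maps (susp A) (susp X) <-> no_maps A X.
Proof.
split=> AX f; first by apply: suspm_inj; rewrite suspm0; exact: AX.
by have [g <-] := suspm_surj f; rewrite (AX g) suspm0.
Qed.

Lemma no_maps_suspl A X : no_maps (susp A) X <-> no_maps A (desusp X).
Proof.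
split=> AX.
  by apply/no_maps_susp/(no_maps_isor (isomorphic_sym (isomorphic_susp_desusp X))).
exact/(no_maps_isor (isomorphic_susp_desusp X))/no_maps_susp.
Qed.

Lemma no_maps_suspr A X : no_maps A (susp X) <-> no_maps (desusp A) X.
Proof.
split=> AX.
  by apply/no_maps_susp/(no_maps_isol (isomorphic_sym (isomorphic_susp_desusp A))).
exact/(no_maps_isol (isomorphic_susp_desusp A))/no_maps_susp.
Qed.

(** Isomorphic to shift (- i) A; defined by cases on i so that the adjunction
    with shift i is an induction on the iteration. *)
Definition coshift i A : T :=
  match i with
  | Posz n => iter n (@desusp T) A
  | Negz n => iter n.+1 (@susp T) A
  end.

Lemma no_maps_coshift i A X : no_maps (coshift i A) X <-> no_maps A (shift i X).
Proof.
have down (n : nat) A' X' :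
    no_maps (iter n (@desusp T) A') X' <-> no_maps A' (iter n (@susp T) X').
  by elim: n A' => // n IH A'; rewrite iterSr /= no_maps_suspr; exact: IH.
have up (n : nat) A' X' :
    no_maps (iter n (@susp T) A') X' <-> no_maps A' (iter n (@desusp T) X').
  by elim: n A' => // n IH A'; rewrite iterSr /= -no_maps_suspl; exact: IH.
by case: i => n; [exact: down|exact: (up n.+1 A X)].
Qed.

Lemma coshift_susp i A : isomorphic (susp (coshift (i + 1) A)) (coshift i A).
Proof.
case: i => [n|[|n]]; first by rewrite -PoszD addn1; exact: isomorphic_susp_desusp.
  exact: isomorphic_refl.
by rewrite (_ : Negz n.+1 + 1 = Negz n); [exact: isomorphic_refl|lia].
Qed.

Lemma no_maps_coshift_susp i A X :
  no_maps (coshift (i + 1) A) X <-> no_maps (coshift i A) (susp X).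
Proof.
rewrite -no_maps_susp; split; apply: no_maps_isol; first exact: coshift_susp.
exact: isomorphic_sym (coshift_susp i A).
Qed.

Lemma no_maps_coshift_add i j n A :
  no_maps (coshift (j + n) A) (coshift (i + n) A) <->
  no_maps (coshift j A) (coshift i A).
Proof.
have step i' j' : no_maps (coshift (j' + 1) A) (coshift (i' + 1) A) <->
    no_maps (coshift j' A) (coshift i' A).
  rewrite no_maps_coshift_susp; split; apply: no_maps_isor; first exact: coshift_susp.
  exact: isomorphic_sym (coshift_susp i' A).
have up (m : nat) i' j' : no_maps (coshift (j' + m%:Z) A) (coshift (i' + m%:Z) A) <->
    no_maps (coshift j' A) (coshift i' A).
  elim: m => [|m IH]; first by rewrite !addr0.
  have e (k : int) : k + m.+1%:Z = k + m%:Z + 1 by lia.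
  by rewrite !e step.
case: n => n; first exact: up.
have e (k : int) : k + Negz n + n.+1%:Z = k by lia.
by have := up n.+1 (i + Negz n) (j + Negz n); rewrite !e => ->.
Qed.

End Orthogonality.

Lemma compact_coshift (T : triangulated) i (A : T) :
  compact_ob A -> compact_ob (coshift i A).
Proof.
move=> cA; case: i => n; rewrite /coshift.
  by elim: n => //= n; exact: compact_ob_desusp.
by elim: n.+1 => //= m; rewrite compact_ob_susp.
Qed.

Section Truncation.
Context (T : big_tt_category) (conn : unit_connectively_generates T).
Implicit Types (X Y : T) (i j n : int).
Notation E i := (coshift i (𝟙 : T)).

Lemma compact_E i : compact_ob (E i).
Proof. by apply: compact_coshift; exact: big_unit_compact. Qed.

Lemma connective i j : (i < j)%R -> no_maps (E j) (E i).
Proof.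
move=> ij; have := no_maps_coshift_add 0 (j - i) i (𝟙 : T).
rewrite subrK add0r => ->; rewrite no_maps_coshift; apply: conn.2; lia.
Qed.

Lemma no_maps_coproduct (I : Set) (F : I -> T) (S : T) (inj : forall k, hom (F k) S) C :
  is_coproduct inj -> compact_ob C -> (forall k, no_maps C (F k)) -> no_maps C S.
Proof.
move=> cp cC CF f; have [s [g ->]] := cC _ _ _ _ cp f.
by rewrite big1 // => k _; rewrite (CF k (g k)) compm0.
Qed.

(** Coning off all maps from the E i with i <= n. By connectivity this does
    not touch the maps from the E j with j > n, and adds none from these or E n. *)
Lemma kill_step n Y : exists (Y' : T) (y : hom Y Y'),
  [/\ forall i (f : hom (E i) Y), (i <= n)%R -> y ∘ f = 0,
      forall j (f : hom (E j) Y), (n < j)%R -> y ∘ f = 0 -> f = 0 &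
      forall j (f : hom (E j) Y'), (n <= j)%R -> exists f', f = y ∘ f'].
Proof.
pose I : Set := {p : {i : int | (i <= n)%R} & hom (E (sval p)) Y}.
have [G [inj cp]] := big_coprod (fun p : I => E (sval (projT1 p))).
have [phi [phiE _]] := cp Y (fun p : I => projT2 p).
have noG j : (n < j)%R -> no_maps (E j) G.
  move=> nj; apply: (no_maps_coproduct cp (@compact_E j)) => -[[i ni] f] /=.
  by apply: connective; lia.
have [Y' [y [h d]]] := dist_cone phi; exists Y', y; split.
- move=> i f ni; have /= <- := phiE (existT _ (exist _ i ni) f).
  by rewrite compA (dist_comp0 d) comp0m.
- move=> j f nj yf; have [f' ->] := dist_lift d yf.
  by rewrite (noG j nj f') compm0.
- move=> j f nj; apply: (dist_lift_rot d).
  have /no_maps_coshift_susp : no_maps (E (j + 1)) G by apply: noG; lia.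
  exact.
Qed.

(** Desuspend the cone of q; the sign of rotation is absorbed into f. *)
Lemma fibre X B (q : hom X B) :
  exists (A : T) (f : hom A X) (h : hom B (susp A)), dist f q h.
Proof.
have [C [c [e d]]] := dist_cone q.
have [u Iu] := susp_desusp C; have [u' [u'u uu']] := Iu.
have [f fE] := suspm_surj (e ∘ u); exists (desusp C), (- f), (u' ∘ c).
apply/dist_rot; rewrite suspmN opprK fE.
apply: (dist_iso (is_iso_id X) (is_iso_id B) _ _ _ _ d (w := u')).
- by exists u.
- by rewrite comp_idl comp_idr.
- by rewrite comp_idr.
- by rewrite suspm_id comp_idl -compA uu' comp_idr.
Qed.

(** Iterate the previous step and let B be the homotopy colimit. For i <= n any
    map from E i to B comes from a finite stage and dies at the next one. For
    j > n, the maps from E j to X and to B coincide, and those from E n to X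
    still surject onto those to B, so the fibre of X -> B receives no map from
    E j. *)
Lemma truncation_exists n X : exists AB, is_truncation n X AB.
Proof.
pose next Y := cid (kill_step n Y).
pose Y m : T := iter m (fun Y => sval (next Y)) X.
pose yP m := cid (svalP (next (Y m))); pose y m : hom (Y m) (Y m.+1) := sval (yP m).
have y_kill m i (f : hom (E i) (Y m)) : (i <= n)%R -> y m ∘ f = 0.
  by have [+ _ _] := svalP (yP m); apply.
have y_inj m j (f : hom (E j) (Y m)) : (n < j)%R -> y m ∘ f = 0 -> f = 0.
  by have [_ + _] := svalP (yP m); apply.
have y_surj m j (f : hom (E j) (Y m.+1)) : (n <= j)%R -> exists f', f = y m ∘ f'.
  by have [_ _ +] := svalP (yP m); apply.
have [B [q [qy lift kill]]] := telescope y.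
have q_surj j (f : hom (E j) B) : (n <= j)%R -> exists f', f = q 0%N ∘ f'.
  move=> nj; have [m [g ->]] := lift _ f (@compact_E j).
  elim: m g => [|m IH] g; first by exists g.
  by have [g' ->] := y_surj m j g nj; rewrite compA qy; exact: IH.
have q_inj j (f : hom (E j) X) : (n < j)%R -> q 0%N ∘ f = 0 -> f = 0.
  move=> nj qf; have [m] := kill _ f (@compact_E j) qf.
  elim: m => [|m IH] /=; first by rewrite comp_idl.
  by rewrite -compA => /(y_inj _ _ _ nj).
have [A [f [h d]]] := fibre (q 0%N).
exists (A, B); split=> [i ni /=|i ni /=|]; last by exists f, (q 0%N), h.
- apply/no_maps_coshift => g.
  have fg : f ∘ g = 0.
    by apply: (q_inj i) => //; rewrite compA (dist_comp0 d) comp0m.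
  have [|w wE] := dist_lift_rot2 d (u := suspm g).
    by rewrite -suspm_comp fg suspm0.
  apply: suspm_inj; rewrite suspm0 wE.
  have iso := coshift_susp (i - 1) (𝟙 : T); rewrite subrK in iso.
  have [u [u' [u'u uu']]] := iso.
  have [|w' w'E] := q_surj (i - 1) (w ∘ u'); first by lia.
  rewrite -[w]comp_idr -u'u (compA w) w'E !compA (dist_comp0_rot d).
  by rewrite !comp0m.
- apply/no_maps_coshift => g; have [m [k ->]] := lift _ g (@compact_E i).
  by rewrite -qy -compA y_kill ?compm0 //; lia.
Qed.

Lemma truncationP n X : is_truncation n X (truncation n X).
Proof.
rewrite /truncation; case: pselect => [e|[]]; last exact: truncation_exists.
exact: svalP (cid e).
Qed.

(** The two truncation triangles identify the maps from 𝟙 to Y and to H^0(Y),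
    through maps Y <- τ≤0 Y -> H^0(Y), hence compatibly with the action of
    End(𝟙). *)
Lemma cohomology_roof Y :
  exists (A : T) (a : hom A Y) (b : hom A (tau_ge 0 (tau_le 0 Y))),
  [/\ forall f : hom 𝟙 A, a ∘ f = 0 -> f = 0,
      forall f : hom 𝟙 Y, exists f', f = a ∘ f',
      forall f : hom 𝟙 A, b ∘ f = 0 -> f = 0 &
      forall f, exists f' : hom 𝟙 A, f = b ∘ f'].
Proof.
rewrite /tau_ge; set A := tau_le 0 Y.
have [_ B1 [a [g [h d]]]] := truncationP 0 Y.
have [A1 _ [a' [b [h' d']]]] := truncationP (0 - 1) A.
exists A, a, b; split=> f.
- move=> af; have [|w wE] := dist_lift_rot2 d (u := suspm f).
    by rewrite -suspm_comp af suspm0.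
  have /no_maps_suspl B0 : no_maps 𝟙 (desusp (truncation 0 Y).2) by exact: (B1 (-1)).
  by apply: suspm_inj; rewrite wE (B0 w) compm0 suspm0.
- by apply: (dist_lift d); exact: (B1 0).
- by move=> bf; have [f' ->] := dist_lift d' bf; rewrite (A1 0 isT f') compm0.
- by apply: (dist_lift_rot d'); exact: (A1 1).
Qed.

End Truncation.

Lemma torsion_cohomology (T : big_tt_category) (P : Spc T) i (X : T) :
  affine T -> unit_connectively_generates T ->
  (exists f : hom 𝟙 (shift i X), ~ torsion_map P f) <->
  (exists f : hom 𝟙 (cohomology i X), ~ torsion_map P f).
Proof.
move=> aff conn.
have [A [a [b [a_inj a_surj b_inj b_surj]]]] := cohomology_roof conn (shift i X).
have reflect W (c : hom A W) (f : hom 𝟙 A) :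
    (forall f : hom 𝟙 A, c ∘ f = 0 -> f = 0) -> torsion_map P (c ∘ f) -> torsion_map P f.
  by move=> c_inj [s Ps fs]; exists s => //; apply: c_inj; rewrite compA.
split=> -[f].
  have [f' ->] := a_surj f => nf; exists (b ∘ f') => /(reflect _ _ _ b_inj).
  by move/(torsion_map_compl a).
have [f' ->] := b_surj f => nf; exists (a ∘ f') => /(reflect _ _ _ a_inj).
by move/(torsion_map_compl b).
Qed.

Theorem theorem9p16 (T : big_tt_category) :
  affine T ->
  unit_generates T ->
  unit_connectively_generates T ->
  forall X : T, tw_supp X = \bigcup_(i : int) supp (cohomology i X).
Proof.
move=> aff _ conn X; apply/seteqP; split=> [P|P [i _]].
  move=> /(tw_supp_torsion aff)[i /(torsion_cohomology _ _ _ aff conn) Hi].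
  by exists i => //; apply/(supp_torsion aff).
move=> /(supp_torsion aff) /(torsion_cohomology _ _ _ aff conn)[f nf].
by apply/(tw_supp_torsion aff); exists i, f.
Qed.
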